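(* Suppose $P\mapsto R_P$ and $P\mapsto S_P$ belong to the class $\mathcal{S}$ and that $R_0(O)\overset{d}{=}S_0(O)$ when $O\sim P_0$. Then the parameter $\Psi:\mathcal{M}\to\mathbb{R}$ is second-order pathwise differentiable at $P_0$ with second-order canonical gradient $D_2^\Psi(P_0)\triangleq 2\Gamma_0$.
   Context: Model and parameters. $\mathcal{M}$ is the nonparametric model of distributions for an observation $O$ taking values in $\mathcal{O}$ (so the tangent space at $P$ is all of $L_0^2(P)$, the mean-zero functions in $L^2(P)$). $P_0\in\mathcal{M}$ is the true distribution. $P\mapsto R_P$ and $P\mapsto S_P$ map $\mathcal{M}$ into bounded real-valued measurable functions on $\mathcal{O}$. A subscript $0$ denotes evaluation at $P_0$ (e.g. $R_0=R_{P_0}$, $\Gamma_0=\Gamma_{P_0}$). For mappings $T,U$ of this type, $$\Phi^{TU}(P)\triangleq\iint e^{-[T_P(o_1)-U_P(o_2)]^2}dP(o_1)dP(o_2),\qquad \Psi(P)\triangleq\Phi^{RR}(P)-2\Phi^{RS}(P)+\Phi^{SS}(P).$$ Class $\mathcal{S}$: all mappings $T$ for which there is a measurable function $X^T$ on $\mathcal{O}$ (write $x^T=X^T(o)$, and $T_P(o)=T_P(x^T)$) such that: (S1) $T_P$ is a measurable mapping with domain $\{X^T(o):o\in\mathcal{O}\}$ and range contained in $[-b,b]$ for some $0\le b<\infty$ independent of $P$; (S2) for all submodels $dP_t/dP=1+th$ with bounded $h$, $Ph=0$, there exist $\delta>0$ and a set $\mathcal{O}_1\subseteq\mathcal{O}$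 with $P_0(\mathcal{O}_1)=1$ such that for all $(o,t_1)\in\mathcal{O}_1\times(-\delta,\delta)$, $t\mapsto T_{P_t}(x^T)$ is twice differentiable at $t_1$ with first and second derivatives uniformly bounded (in $x^T$); (S3) for any $P\in\mathcal{M}$ and submodel $dP_t/dP=1+th$ with bounded $h$, $Ph=0$, there is a function $D_P^T:\mathcal{O}\to\mathbb{R}$ (depending on $T$ and $P$, not on $h$, as the notation indicates), uniformly bounded in $P$ and $o$, such that $\int D_P^T(o)\,dP(o|x^T)=0$ for almost all $o\in\mathcal{O}$ and $\frac{d}{dt}T_{P_t}(x^T)|_{t=0}=\int D_P^T(o)h(o)\,dP(o|x^T)$, where $P(\cdot|x^T)$ is the conditional distribution of $O$ given $X^T=x^T$ under $P$. For $T,U\in\mathcal{S}$, $$\Gamma_P^{TU}(o_1,o_2)\triangleq\Big[2[T_P(o_1)-U_P(o_2)][D_P^U(o_2)-D_P^T(o_1)]+1-\{4[T_P(o_1)-U_P(o_2)]^2-2\}D_P^T(o_1)D_P^U(o_2)\Big]e^{-[T_P(o_1)-U_P(o_2)]^2},$$ and $\Gamma_P\triangleq\Gamma_P^{RR}-\Gamma_P^{RS}-\Gamma_P^{SR}+\Gamma_P^{SS}$. Second-order pathwise differentiability at $P_0$. Consider submodels $dP_t=(1+th_1+t^2h_2)dP_0$ with $h_1,h_2$ bounded and $P_0h_1=P_0h_2=0$ (notation $Pf=\int f\,dP$). $\Psi$ is first-order pathwise differentiable with canonical gradient $D_1^\Psi\in L_0^2(P_0)$ if $\Psi(P_t)-\Psi(P_0)=tP_0[D_1^\Psi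 h_1]+o(t)$. A function $f:\mathcal{O}^2\to\mathbb{R}$ is $P_0$ one-degenerate if it is symmetric and $\int f(o,o_2)dP_0(o_2)=0$ for all $o$. $\Psi$ is second-order pathwise differentiable at $P_0$, with second-order canonical gradient $D_2^\Psi$, if there is a symmetric, one-degenerate, $P_0^2$-square-integrable function $D_2^\Psi$ such that for all such submodels $$\Psi(P_t)-\Psi(P_0)=tP_0[D_1^\Psi h_1]+\tfrac12t^2P_0[D_1^\Psi h_2]+\tfrac12t^2\iint D_2^\Psi(o_1,o_2)h_1(o_1)h_1(o_2)dP_0(o_2)dP_0(o_1)+o(t^2).$$ *)

(* Defs.v *)
From HB Require Import structures.
From mathcomp Require Import all_boot all_order all_algebra.
From mathcomp Require Import all_classical all_reals all_analysis.

Set Implicit Arguments.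
Unset Strict Implicit.
Unset Printing Implicit Defensive.

Import Order.TTheory GRing.Theory Num.Theory.
Import numFieldNormedType.Exports.

Local Open Scope classical_set_scope.
Local Open Scope ring_scope.

Section Definitions.
Context (R : realType) (d : measure_display) (O : measurableType d).

(* A statistical model is a set of laws.  A mapping P |-> T_P from the model to
   functions on O is represented by T : law -> O -> R; its values at laws
   outside the model are irrelevant. *)
Local Notation law := (probability O R).
Local Notation mapping := (law -> O -> R).

Definition has_density (P : law) (g : O -> R) (Q : law) : Prop :=
  forall A, measurable A -> Q A = (\int[P]_(o in A) (g o)%:E)%E.

(* h is bounded, measurable, and Ph = 0. *)
Definition bounded_score (P : law) (h : O -> R) : Prop :=
  [/\ measurable_fun setT h,
      exists C : R, forall o, `|h o| <= C
    & \int[P]_o h o = 0].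

(* t |-> P_t is a submodel of M through P with dP_t/dP = g t.  Only small t
   matter: 1 + t h is a density only near t = 0.  The condition Pt 0 = P is
   explicit because a measure in the library is a function on all sets, of
   which a density determines only the values on measurable sets. *)
Definition submodel (M : set law) (P : law) (g : R -> O -> R) (Pt : R -> law) :
    Prop :=
  Pt 0 = P /\ \forall t \near 0, M (Pt t) /\ has_density P (g t) (Pt t).

Definition linear_path (h : O -> R) : R -> O -> R :=
  fun t o => 1 + t * h o.

Definition quadratic_path (h1 h2 : O -> R) : R -> O -> R :=
  fun t o => 1 + t * h1 o + t ^+ 2 * h2 o.

(* No restriction is put on the laws in M other than openness: around each
   P in M, every sufficiently small bounded perturbation of P stays in M.  Thus
   every bounded score at P is the score of a submodel, and as these are dense
   in L^2_0(P), the tangent space is all of L^2_0(P).  The set of all laws on O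
   is an instance. *)
Definition nonparametric (M : set law) : Prop :=
  forall P, M P -> exists2 delta : R, 0 < delta &
    forall (h : O -> R) (Q : law),
      bounded_score P h -> (forall o, `|h o| <= delta) ->
      has_density P (fun o => 1 + h o) Q -> M Q.

(* kappa is a regular version of P(. | x^T), the conditional distribution of
   the observation given X^T under P. *)
Definition cond_distribution (P : law) (dX : measure_display)
    (X : measurableType dX) (xT : O -> X) (kappa : R.-pker X ~> O) : Prop :=
  forall (A : set O) (B : set X), measurable A -> measurable B ->
    P (A `&` xT @^-1` B) = (\int[P]_(o in xT @^-1` B) kappa (xT o) A)%E.

Definition S1 (M : set law) (dX : measure_display) (X : measurableType dX)
    (xT : O -> X) (T : mapping) : Prop :=
  exists2 b : R, 0 <= b & forall P, M P ->
    exists tP : X -> R,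
      [/\ measurable_fun setT tP,
          forall o, T P o = tP (xT o)
        & forall o, - b <= tP (xT o) <= b].

(* The null set is relative to the true law P0, for submodels through any
   P in M. *)
Definition S2 (M : set law) (P0 : law) (T : mapping) : Prop :=
  forall (P : law) (h : O -> R) (Pt : R -> law),
    M P -> bounded_score P h -> submodel M P (linear_path h) Pt ->
    exists (delta : R) (O1 : set O),
      [/\ 0 < delta, measurable O1, P0 O1 = 1%E
        & forall t1 : R, - delta < t1 < delta ->
          exists C : R, forall o, O1 o ->
            let f := fun t : R => T (Pt t) o in
            [/\ derivable f t1 1, derivable (f^`())%classic t1 1,
                `|(f^`())%classic t1| <= C & `|(f^`(2))%classic t1| <= C]].

Definition S3 (M : set law) (dX : measure_display) (X : measurableType dX)
    (xT : O -> X) (T D : mapping) : Prop :=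
  (exists B : R, forall P o, M P -> `|D P o| <= B) /\
  forall P, M P ->
    measurable_fun setT (D P) /\
    exists kappa : R.-pker X ~> O,
      [/\ cond_distribution P xT kappa,
          {ae P, forall o, \int[kappa (xT o)]_o' D P o' = 0}
        & forall (h : O -> R) (Pt : R -> law),
            bounded_score P h -> submodel M P (linear_path h) Pt ->
            {ae P, forall o, is_derive (0 : R) (1 : R)
               (fun t : R => T (Pt t) o)
               (\int[kappa (xT o)]_o' (D P o' * h o'))}].

(* T belongs to the class, with D_P^T = D P.  The family D is an argument since
   Gamma depends on it; (S3) determines each D P up to P-null sets. *)
Definition classS (M : set law) (P0 : law) (T D : mapping) : Prop :=
  exists (dX : measure_display) (X : measurableType dX) (xT : O -> X),
    [/\ measurable_fun setT xT, S1 M xT T, S2 M P0 T & S3 M xT T D].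

Definition Phi (T U : mapping) (P : law) : R :=
  \int[P]_o2 \int[P]_o1 expR (- (T P o1 - U P o2) ^+ 2).

Definition Psi (Rm Sm : mapping) (P : law) : R :=
  Phi Rm Rm P - 2 * Phi Rm Sm P + Phi Sm Sm P.

Definition Gamma2 (T U DT DU : mapping) (P : law) (o1 o2 : O) : R :=
  (2 * (T P o1 - U P o2) * (DU P o2 - DT P o1) + 1
   - (4 * (T P o1 - U P o2) ^+ 2 - 2) * DT P o1 * DU P o2)
  * expR (- (T P o1 - U P o2) ^+ 2).

Definition Gamma (Rm Sm DR DS : mapping) (P : law) (o1 o2 : O) : R :=
  Gamma2 Rm Rm DR DR P o1 o2 - Gamma2 Rm Sm DR DS P o1 o2
  - Gamma2 Sm Rm DS DR P o1 o2 + Gamma2 Sm Sm DS DS P o1 o2.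

Definition eq_in_distribution (P : law) (f g : O -> R) : Prop :=
  forall B : set R, measurable B -> pushforward P f B = pushforward P g B.

(* The tangent space being L^2_0(P0), every gradient is canonical. *)
Definition first_order_gradient (M : set law) (Ps : law -> R) (P0 : law)
    (D1 : O -> R) : Prop :=
  [/\ D1 \in Lfun P0 2%:E, \int[P0]_o D1 o = 0
    & forall (h1 h2 : O -> R) (Pt : R -> law),
        bounded_score P0 h1 -> bounded_score P0 h2 ->
        submodel M P0 (quadratic_path h1 h2) Pt ->
        (fun t : R => Ps (Pt t) - Ps P0 - t * \int[P0]_o (D1 o * h1 o))
          =o_ (0 : R) (fun t : R => t)].

Definition one_degenerate (P0 : law) (f : O -> O -> R) : Prop :=
  (forall o1 o2, f o1 o2 = f o2 o1) /\
  (forall o, (\int[P0]_o2 (f o o2)%:E = 0)%E).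

Definition second_order_gradient (M : set law) (Ps : law -> R) (P0 : law)
    (D2 : O -> O -> R) : Prop :=
  [/\ one_degenerate P0 D2,
      (fun z : O * O => D2 z.1 z.2) \in Lfun (P0 \x P0)%E 2%:E
    & exists2 D1 : O -> R, first_order_gradient M Ps P0 D1 &
      forall (h1 h2 : O -> R) (Pt : R -> law),
        bounded_score P0 h1 -> bounded_score P0 h2 ->
        submodel M P0 (quadratic_path h1 h2) Pt ->
        (fun t : R => Ps (Pt t) - Ps P0
           - (t * \int[P0]_o (D1 o * h1 o)
              + 2^-1 * t ^+ 2 * \int[P0]_o (D1 o * h2 o)
              + 2^-1 * t ^+ 2 * \int[P0]_o1 \int[P0]_o2
                                   (D2 o1 o2 * h1 o1 * h1 o2)))
          =o_ (0 : R) (fun t : R => t ^+ 2)].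

End Definitions.

(* Main.v *)
(* Psi(P) is the squared Gaussian-kernel mean discrepancy between the laws of
   R_P(O) and S_P(O).  Under the null hypothesis the cross terms of the second
   difference cancel, so that
     Psi(P_t) - Psi(P_0) = A^RR - 2 A^RS + A^SS,
   where A^TU integrates over P_0 x P_0 the mixed second difference of
   p_t(o1) p_t(o2) k(T(o1) - U(o2)), with p_t = dP_t/dP_0 and k(u) = exp(-u^2),
   between times 0 and t in o1 and in o2 separately.  Hence only first-order
   information on t |-> T_{P_t} is needed: A^TU / t^2 converges, by dominated
   convergence, to the integral of the mixed second derivative, which is
   Gamma^TU h1 h1 once the derivative of T is replaced by D^T h1 (the two have
   the same conditional mean given X^T).  In particular the first-order gradient
   is 0.
   Domination and the passage from linear to quadratic submodels both follow
   from one estimate: T is Lipschitz, almost surely, in the sup norm of the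
   density, because its derivative along the segment joining two nearby laws is
   bounded by means of (S3), uniformly since D is. *)
From HB Require Import structures.
Require Import Defs.
From mathcomp Require Import all_boot all_order all_algebra.
From mathcomp Require Import all_classical all_reals all_analysis.
From mathcomp Require Import measurable_realfun ring lra.

Set Implicit Arguments.
Unset Strict Implicit.
Unset Printing Implicit Defensive.

Import Order.TTheory GRing.Theory Num.Theory.
Import numFieldNormedType.Exports.

Local Open Scope classical_set_scope.
Local Open Scope ring_scope.

(** * Integrals of bounded measurable functions *)

Section BoundedMeasurable.
Context (R : realType) (d : measure_display) (T : measurableType d).
Implicit Types (f g : T -> R) (mu : probability T R).

(** The obstacle is the null sets. (S3) excludes one for each time, null under the law at that time,
    and the neighbourhood given by (S2) depends on the base law. Hence densities relative to P0 are
    kept above 1/2, which turns null sets of nearby laws into null sets of P0; (S3) is invoked at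
    rational times only, and limits are taken along sequences t_n, so that only countably many null
    sets are united. A segment of densities is a linear submodel through each of its interior laws,
    up to a rescaling of the score, so hypotheses on linear submodels suffice for the Lipschitz
    estimate. An equality of conditional means suffices in the limit of A^TU / t^2 because this
    limit is affine in the derivative of T, with a coefficient that depends on o1 through T(o1)
    only; likewise for U and o2. The same mechanism, applied to the centering of D in (S3), makes
    Gamma one-degenerate. All functions that are integrated are bounded and measurable, so
    integrability is automatic, and identities between integrals are extended from indicators by a
    single lemma on sup-norm bounded functionals. *)

Definition bmeas f := measurable_fun setT f /\ exists C : R, forall x, `|f x| <= C.

Lemma bmeas_cst c : bmeas (cst c).
Proof. by split; [exact: measurable_cst|exists `|c|]. Qed.

Lemma bmeasD f g : bmeas f -> bmeas g -> bmeas (fun x => f x + g x).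
Proof.
move=> [mf [C fC]] [mg [D gD]]; split; first exact: measurable_funD.
by exists (C + D) => x; rewrite (le_trans (ler_normD _ _))// lerD.
Qed.

Lemma bmeasN f : bmeas f -> bmeas (fun x => - f x).
Proof.
move=> [mf [C fC]]; split; first exact: measurableT_comp.
by exists C => x; rewrite normrN.
Qed.

Lemma bmeasB f g : bmeas f -> bmeas g -> bmeas (fun x => f x - g x).
Proof. by move=> bf bg; apply: bmeasD => //; exact: bmeasN. Qed.

Lemma bmeasM f g : bmeas f -> bmeas g -> bmeas (fun x => f x * g x).
Proof.
move=> [mf [C fC]] [mg [D gD]]; split; first exact: measurable_funM.
by exists (C * D) => x; rewrite normrM ler_pM.
Qed.

Lemma bmeasX f n : bmeas f -> bmeas (fun x => f x ^+ n).
Proof.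
move=> bf; elim: n => [|n IH]; first exact: (bmeas_cst 1).
rewrite (_ : (fun x => _) = fun x => f x * f x ^+ n); first exact: bmeasM.
by apply/funext => x; rewrite exprS.
Qed.

Lemma bmeas_indic (A : set T) : measurable A -> bmeas (\1_A).
Proof.
move=> mA; split; first exact: measurable_indic.
exists 1 => x; rewrite indicE; case: (_ \in _) => /=; by rewrite ?normr1 ?normr0.
Qed.

Lemma bmeas_integrable mu f : bmeas f -> mu.-integrable setT (EFin \o f).
Proof.
move=> [mf [C fC]]; apply: measurable_bounded_integrable => //.
- by apply: (le_lt_trans (probability_le1 mu measurableT)); rewrite ltry.
- exists C; split; first exact: num_real.
  by move=> D CD x _ /=; rewrite (le_trans (fC x))// ltW.
Qed.

Lemma Rint_bmeasD mu f g : bmeas f -> bmeas g ->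
  \int[mu]_x (f x + g x) = \int[mu]_x f x + \int[mu]_x g x.
Proof. by move=> bf bg; rewrite RintegralD//; exact: bmeas_integrable. Qed.

Lemma Rint_bmeasB mu f g : bmeas f -> bmeas g ->
  \int[mu]_x (f x - g x) = \int[mu]_x f x - \int[mu]_x g x.
Proof. by move=> bf bg; rewrite RintegralB//; exact: bmeas_integrable. Qed.

Lemma Rint_bmeasZ mu c f : bmeas f ->
  \int[mu]_x (c * f x) = c * \int[mu]_x f x.
Proof. by move=> bf; rewrite RintegralZl//; exact: bmeas_integrable. Qed.

Lemma Rint_cst mu c : \int[mu]_x c = c.
Proof.
rewrite (_ : (fun=> c) = cst c)// Rintegral_cst//.
by rewrite -[RHS]mulr1; congr (_ * _); exact: (congr1 fine (probability_setT mu)).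
Qed.

Lemma normr_Rint_le mu f C : bmeas f -> (forall x, `|f x| <= C) ->
  `|\int[mu]_x f x| <= C.
Proof.
move=> bf fC; apply: le_trans (le_normr_Rintegral _ _) _ => //.
  exact: bmeas_integrable.
rewrite -[leRHS](Rint_cst mu); apply: le_Rintegral => //.
- apply: bmeas_integrable; case: bf => mf _; split; first exact: measurableT_comp.
  by exists C => x; rewrite normr_id.
- by apply: bmeas_integrable; exact: bmeas_cst.
Qed.

Lemma Rint_indic mu (A : set T) : measurable A ->
  \int[mu]_x (\1_A x) = fine (mu A).
Proof. by move=> mA; rewrite /Rintegral integral_indic// setIT. Qed.

(* For f >= 0, the step functions sum_k 1[k + 1 <= n f] / n converge to f
   uniformly, and [f] can be made nonnegative by adding a constant. *)
Lemma bmeas_functional0 (L : (T -> R) -> R) (K : R) :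
  (forall f g, bmeas f -> bmeas g -> L (fun x => f x + g x) = L f + L g) ->
  (forall c f, bmeas f -> L (fun x => c * f x) = c * L f) ->
  (forall f (C : R), bmeas f -> (forall x, `|f x| <= C) -> `|L f| <= K * C) ->
  (forall A, measurable A -> L (\1_A) = 0) ->
  forall f, bmeas f -> L f = 0.
Proof.
move=> LD LZ LK LA.
have L1 : L (cst 1) = 0.
  rewrite -(LA setT measurableT); congr L; apply/funext => x.
  by rewrite indicE in_setT.
pose step (y : T -> R) (M : nat) (x : T) : R :=
  \sum_(k < M) \1_[set z | k.+1%:R <= y z] x.
have Lstep (y : T -> R) : bmeas y -> forall M, bmeas (step y M) /\ L (step y M) = 0.
  move=> [my _]; elim=> [|M [bs Ls]] /=.
    have -> : step y 0%N = (cst 0).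
      by apply/funext => x; rewrite /step big_ord0.
    split; first exact: bmeas_cst.
    have -> : cst 0 = (fun x : T => 0 * (cst 1) x) :> (T -> R).
      by apply/funext => x; rewrite mul0r.
    by rewrite LZ ?mul0r//; exact: bmeas_cst.
  have mA : measurable [set x | M.+1%:R <= y x].
    by rewrite -[X in measurable X]setTI;
      exact: (measurable_fun_le measurableT (measurable_cst _) my).
  have -> : step y M.+1 = (fun x => step y M x + \1_[set z | M.+1%:R <= y z] x).
    by apply/funext => x; rewrite /step big_ord_recr.
  split; first by apply: bmeasD => //; exact: bmeas_indic.
  by rewrite LD//; [rewrite Ls LA// addr0|exact: bmeas_indic].
(* The sum is the integer part of y capped at M, hence within 1 of [Order.min y M]. The second
   clause carries the induction past M. *)
have count (y : R) (M : nat) : 0 <= y ->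
    0 <= Order.min y M%:R - \sum_(k < M) (k.+1%:R <= y)%R%:R <= 1 /\
    (M%:R <= y -> \sum_(k < M) (k.+1%:R <= y)%R%:R = M%:R :> R).
  move=> y0; elim: M => [|M [IH1 IH2]].
    by rewrite big_ord0 mulr0n subr0 (min_idPr y0) lexx ler01; split.
  rewrite big_ord_recr /= -natr1; case: (leP (M%:R + 1) y) => My.
    have MyW : M%:R <= y by rewrite (le_trans _ My)// lerDl.
    rewrite (IH2 MyW); split => //=.
    by rewrite subrr lexx ler01.
  rewrite addr0; split=> //.
  case: (leP M%:R y) IH1 => MyW IH1; last exact: IH1.
  by rewrite IH2//; lra.
move=> f bf; have [mf [C fC]] := bf.
pose N := (Num.truncn `|C|).+1.
have fN x : `|f x| <= N%:R.
  by rewrite (le_trans (fC x))// (le_trans (ler_norm _))// ltW// truncnS_gt.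
(* With y = n.+1 * (f + N), L vanishes on constants, so L y = n.+1 * L f; it vanishes on the step
   function of y too, and the remainder is at most 1 in sup norm, so K bounds |L y| for every n. *)
suff H n : n.+1%:R * `|L f| <= K.
  apply/eqP; rewrite -normr_eq0; apply/eqP/le_anti; rewrite normr_ge0 andbT.
  rewrite leNgt; apply/negP => Lf0.
  have := H (Num.truncn (K / `|L f|)).
  by rewrite -ler_pdivlMr// leNgt truncnS_gt.
pose y x := n.+1%:R * (f x + N%:R).
have y0 x : 0 <= y x.
  by rewrite mulr_ge0//; have := fN x; rewrite ler_norml => /andP[]; lra.
have by_ : bmeas y.
  apply: (@bmeasM (cst _)); first exact: bmeas_cst.
  by apply: (@bmeasD f (cst _)) => //; exact: bmeas_cst.
have Ly : L y = n.+1%:R * L f.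
  rewrite LZ; last by apply: (@bmeasD f (cst _)) => //; exact: bmeas_cst.
  rewrite (LD f (cst _))//; last exact: bmeas_cst.
  have -> : cst N%:R = (fun x : T => N%:R * (cst 1) x) :> (T -> R).
    by apply/funext => x; rewrite mulr1.
  by rewrite LZ ?L1 ?mulr0 ?addr0//; exact: bmeas_cst.
(* Since |f| <= N, the number of steps is an upper bound of y and the cap in [count] has no
   effect. *)
have [bs Ls] := Lstep y by_ (n.+1 * (N + N))%N.
set s := step _ _ in bs Ls.
have sE x : s x = \sum_(k < n.+1 * (N + N)) (k.+1%:R <= y x)%R%:R.
  apply: eq_bigr => k _; rewrite indicE; congr (nat_of_bool _)%:R; apply/idP/idP.
    by rewrite inE.
  by move=> h; apply/mem_set.
have bys : bmeas (fun x => y x - s x) by exact: bmeasB.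
have := LK (fun x => y x - s x) 1 bys.
rewrite mulr1.
have -> : L (fun x => y x - s x) = n.+1%:R * L f.
  rewrite -[RHS]Ly -[RHS]addr0 -(mulr0 (-1)) -Ls -LZ//.
  rewrite -LD//; last by apply: (@bmeasM (cst _)) => //; exact: bmeas_cst.
  by congr L; apply/funext => x; rewrite mulN1r.
rewrite normrM ger0_norm//; apply => x.
rewrite sE; have [+ _] := count (y x) (n.+1 * (N + N))%N (y0 x).
rewrite (_ : Order.min _ _ = y x).
  by move=> /andP[? ?]; rewrite ger0_norm.
apply/min_idPl; rewrite /y natrM ler_pM2l// natrD lerD2r.
by rewrite (le_trans (ler_norm _)).
Qed.
End BoundedMeasurable.

Section Comp.
Context (R : realType) (d1 d2 : measure_display) (T1 : measurableType d1)
  (T2 : measurableType d2).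

Lemma bmeas_comp (f : T2 -> R) (g : T1 -> T2) :
  measurable_fun setT g -> bmeas f -> bmeas (f \o g).
Proof.
move=> mg [mf [C fC]]; split; first exact: measurableT_comp.
by exists C => x; exact: fC.
Qed.
End Comp.

Section Fubini.
Context (R : realType) (d1 d2 : measure_display) (T1 : measurableType d1)
  (T2 : measurableType d2) (mu : probability T1 R) (nu : probability T2 R).
Variable (F : T1 * T2 -> R).
Hypothesis bF : bmeas F.

Lemma bmeas_section1 x : bmeas (fun y => F (x, y)).
Proof. by apply: (@bmeas_comp _ _ _ _ _ F) => //; exact: measurable_pair1. Qed.

Lemma bmeas_section2 y : bmeas (fun x => F (x, y)).
Proof. by apply: (@bmeas_comp _ _ _ _ _ F) => //; exact: measurable_pair2. Qed.

Let iF : (mu \x nu)%E.-integrable setT (EFin \o F).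
Proof. exact: (@bmeas_integrable _ _ _ (mu \x nu)%E F). Qed.

Lemma bmeas_Rint2 : bmeas (fun y => \int[mu]_x F (x, y)).
Proof.
split.
  apply: (measurableT_comp (f := fine)); first exact: fine_measurable.
  exact: (measurable_fubini_G iF).
have [_ [C FC]] := bF; exists C => x.
by apply: normr_Rint_le => //; exact: bmeas_section2.
Qed.

Lemma Rint_fubini1 :
  \int[mu]_x \int[nu]_y F (x, y) = \int[(mu \x nu)%E]_z F z.
Proof.
rewrite [RHS]/Rintegral -(integral12_prod_meas1 iF) /Rintegral.
congr fine; apply: eq_integral => x _; rewrite fineK//.
by apply: integrable_fin_num => //; apply: bmeas_integrable; exact: bmeas_section1.
Qed.

Lemma Rint_fubini2 :
  \int[nu]_y \int[mu]_x F (x, y) = \int[(mu \x nu)%E]_z F z.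
Proof.
rewrite [RHS]/Rintegral -(integral21_prod_meas1 iF) /Rintegral.
congr fine; apply: eq_integral => x _; rewrite fineK//.
by apply: integrable_fin_num => //; apply: bmeas_integrable; exact: bmeas_section2.
Qed.
End Fubini.

Lemma ae_prod1 (R : realType) (d1 d2 : measure_display) (T1 : measurableType d1)
  (T2 : measurableType d2) (mu : probability T1 R) (nu : probability T2 R)
  (Q : T1 -> Prop) :
  {ae mu, forall x, Q x} -> {ae (mu \x nu)%E, forall z, Q z.1}.
Proof.
move=> [N [mN N0 NQ]]; exists (N `*` setT); split.
- exact: measurableX.
- by rewrite product_measure1E//; rewrite -[RHS](mul0e (nu setT));
  congr (_ * _)%E; exact: N0.
- by move=> [x y] /= nQ; split => //=; exact: NQ.
Qed.

Lemma ae_prod2 (R : realType) (d1 d2 : measure_display) (T1 : measurableType d1)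
  (T2 : measurableType d2) (mu : probability T1 R) (nu : probability T2 R)
  (Q : T2 -> Prop) :
  {ae nu, forall x, Q x} -> {ae (mu \x nu)%E, forall z, Q z.2}.
Proof.
move=> [N [mN N0 NQ]]; exists (setT `*` N); split.
- exact: measurableX.
- by rewrite product_measure1E//; rewrite -[RHS](mule0 (mu setT));
  congr (_ * _)%E; exact: N0.
- by move=> [x y] /= nQ; split => //=; exact: NQ.
Qed.

Section DCT.
Context (R : realType) (d : measure_display) (T : measurableType d).

Lemma bmeas_dct (mu : probability T R) (f_ : nat -> T -> R) (f : T -> R) (C : R) :
  (forall n, bmeas (f_ n)) -> bmeas f ->
  {ae mu, forall x, f_ n x @[n --> \oo] --> f x} ->
  {ae mu, forall x n, `|f_ n x| <= C} ->
  \int[mu]_x f_ n x @[n --> \oo] --> \int[mu]_x f x.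
Proof.
move=> bf_ bf cvf ubf; apply: fine_cvg.
rewrite fineK; last first.
  by apply: integrable_fin_num => //; exact: bmeas_integrable.
have [] := @dominated_convergence _ _ _ mu setT measurableT
  (fun n x => (f_ n x)%:E) (EFin \o f) (cst C%:E) => //.
- by move=> n; apply/measurable_EFinP; case: (bf_ n).
- by apply/measurable_EFinP; case: bf.
- by apply: filterS cvf => x cx _; apply: cvg_EFin => //; exact: nearW.
- exact: (@bmeas_integrable _ _ _ mu (cst C) (bmeas_cst _ _)).
- by apply: filterS ubf => x ux n _; rewrite /= lee_fin.
Qed.
End DCT.

Lemma Rint_ae_eq (R : realType) (d : measure_display) (T : measurableType d)
    (mu : probability T R) (f g : T -> R) : bmeas f -> bmeas g ->
  {ae mu, forall x, f x = g x} -> \int[mu]_x f x = \int[mu]_x g x.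
Proof.
move=> [mf _] [mg _] fg; congr fine; apply: ae_eq_integral => //.
- exact/measurable_EFinP.
- exact/measurable_EFinP.
- by apply: filterS fg => x -> _.
Qed.


(** * Densities and disintegration *)

Section Density.
Context (R : realType) (d : measure_display) (O : measurableType d).
Local Notation law := (probability O R).

Lemma fine_Rint_indic (P : law) (g : O -> R) A : measurable A ->
  fine (\int[P]_(o in A) (g o)%:E)%E = \int[P]_o (\1_A o * g o).
Proof.
move=> mA; rewrite /Rintegral [in LHS]integral_mkcond; congr fine.
apply: eq_integral => o _; rewrite patchE indicE.
by case: (o \in A); rewrite ?mul1r ?mul0r.
Qed.

(** The difference of the two sides is linear in f, vanishes on indicators by definition of the
    density, and is bounded by 1 + G times the sup norm of f, where G bounds g. *)
Lemma density_Rint (P Q : law) g f : bmeas g -> has_density P g Q -> bmeas f ->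
  \int[Q]_o f o = \int[P]_o (f o * g o).
Proof.
move=> bg hQ bf; apply/eqP; rewrite -subr_eq0; apply/eqP.
have [mg [G gG]] := bg.
apply: (@bmeas_functional0 _ _ _
  (fun f => \int[Q]_o f o - \int[P]_o (f o * g o)) (1 + G)) f bf.
- move=> f1 f2 b1 b2; rewrite Rint_bmeasD//.
  under [X in _ - X]eq_Rintegral do rewrite mulrDl.
  by rewrite Rint_bmeasD; [ring|exact: bmeasM|exact: bmeasM].
- move=> c f b; rewrite Rint_bmeasZ//.
  under [X in _ - X]eq_Rintegral do rewrite -mulrA.
  by rewrite Rint_bmeasZ; [ring|exact: bmeasM].
- move=> f C b fC; rewrite (le_trans (ler_normB _ _))// mulrDl mul1r lerD//.
    exact: normr_Rint_le.
  apply: normr_Rint_le; first exact: bmeasM.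
  by move=> o; rewrite normrM mulrC ler_pM.
- move=> A mA; apply/eqP; rewrite subr_eq0; apply/eqP.
  by rewrite Rint_indic// hQ// fine_Rint_indic.
Qed.

Lemma density_total (P Q : law) g : bmeas g -> has_density P g Q ->
  \int[P]_o g o = 1.
Proof.
move=> bg hQ; rewrite -[RHS](Rint_cst Q 1) (density_Rint bg hQ (bmeas_cst _ 1)).
by apply: eq_Rintegral => o _; rewrite mul1r.
Qed.

(** If N is null for Q, then c * P N <= Q N = 0. This carries almost sure statements under a law
    near P0 back to P0. *)
Lemma density_ae (P Q : law) g c : bmeas g -> has_density P g Q -> 0 < c ->
  (forall o, c <= g o) -> forall A : O -> Prop,
  {ae Q, forall o, A o} -> {ae P, forall o, A o}.
Proof.
move=> bg hQ c0 cg A [N [mN N0 NA]]; exists N; split => //.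
have : Q N = 0%E := N0.
rewrite hQ// => h.
have : (c%:E * P N <= 0)%E.
  rewrite -h -integral_cst//; apply: ge0_le_integral => //.
  - by move=> o _; rewrite lee_fin ltW.
  - by apply/measurable_EFinP/measurable_funTS; case: bg.
  - by move=> o _; rewrite lee_fin.
rewrite pmule_rle0 ?lte_fin// => PN.
by apply/eqP; rewrite eq_le PN measure_ge0.
Qed.

(** The three conditions are arguments so that the instances of measure and probability declared
    below can refer to them. *)
Definition density_measure (P : law) (g : O -> R) of bmeas g &
  (forall o, 0 <= g o) & \int[P]_o g o = 1 := fun A => (\int[P]_(o in A) (g o)%:E)%E.

Section DensityMeasure.
Variables (P : law) (g : O -> R) (bg : bmeas g) (g0 : forall o, 0 <= g o)
  (g1 : \int[P]_o g o = 1).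
Local Notation mu := (density_measure bg g0 g1).

Let mu0 : mu set0 = 0%E.
Proof. by rewrite /density_measure integral_set0. Qed.

Let mu_ge0 A : (0 <= mu A)%E.
Proof. by apply: integral_ge0 => o _; rewrite lee_fin. Qed.

Let mu_sigma_additive : semi_sigma_additive mu.
Proof.
move=> /= F mF tF mUF; rewrite /density_measure; apply: cvg_toP.
  apply: ereal_nondecreasing_is_cvgn => m n mn.
  by apply: lee_sum_nneg_natr => // k _ _; exact: mu_ge0.
rewrite ge0_integral_bigcup//=.
- by apply/measurable_funTS/measurable_EFinP; case: bg.
- by move=> o _; rewrite lee_fin.
Qed.

HB.instance Definition _ := isMeasure.Build _ _ _ mu mu0 mu_ge0 mu_sigma_additive.

Let mu_setT : mu setT = 1%E.
Proof.
rewrite -[LHS]fineK; first by congr EFin.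
by apply: integrable_fin_num => //; exact: bmeas_integrable.
Qed.

HB.instance Definition _ := Measure_isProbability.Build _ _ _ mu mu_setT.

Lemma density_exists : exists Q : law, has_density P g Q.
Proof. by exists mu. Qed.
End DensityMeasure.
End Density.

Section Disintegration.
Context (R : realType) (dX dY : measure_display) (X : measurableType dX)
  (Y : measurableType dY).

(** A name for [k x] to which the structure of a probability is attached, so that the lemmas on
    bounded measurable functions apply to it. *)
Definition kernel_prob (k : R.-pker X ~> Y) (x : X) : set Y -> \bar R := k x.

HB.instance Definition _ k x := Measure.on (kernel_prob k x).
HB.instance Definition _ k x :=
  Measure_isProbability.Build _ _ _ (kernel_prob k x) (prob_kernel x).

Lemma bmeas_kernel (k : R.-pker X ~> Y) f : bmeas f ->
  bmeas (fun x => \int[kernel_prob k x]_y f y).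
Proof.
move=> bf; have [mf [C fC]] := bf; split; last first.
  by exists C => x; exact: normr_Rint_le.
have bfC : bmeas (fun y => f y + cst C y) by apply: bmeasD => //; exact: bmeas_cst.
(* Measurability in x is available for nonnegative integrands; the shift by C is undone exactly
   because each [k x] has mass 1. *)
have -> : (fun x => \int[kernel_prob k x]_y f y) =
  (fun x => fine (\int[kernel_prob k x]_y (f y + cst C y)%:E)%E - C).
  apply/funext => x; rewrite -[X in X - _]/(Rintegral _ _ _).
  rewrite Rint_bmeasD//; last exact: bmeas_cst.
  by rewrite Rint_cst addrK.
apply: measurable_funB => //.
apply: (measurableT_comp (f := fine)); first exact: fine_measurable.
apply: (@measurable_fun_integral_kernel _ _ X Y R (fun x => kernel_prob k x)).
- by move=> U mU; exact: measurable_kernel.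
- by move=> y; rewrite lee_fin -lerBlDr sub0r; have := fC y;
  rewrite ler_norml => /andP[].
- by apply/measurable_EFinP; case: bfC.
Qed.

(** [cond_distribution] is the case of two indicators. The extension from indicators is made twice:
    in f with u the indicator of B, then in u with f fixed; the bounds 2 and 2 * C are those of the
    two functionals. *)
Lemma disintegration (P : probability Y R) (xT : Y -> X) (k : R.-pker X ~> Y)
    (u : X -> R) (f : Y -> R) :
  measurable_fun setT xT -> cond_distribution P xT k -> bmeas u -> bmeas f ->
  \int[P]_o (u (xT o) * f o) =
  \int[P]_o (u (xT o) * \int[kernel_prob k (xT o)]_y f y).
Proof.
move=> mxT hk bu bf.
have bux v : bmeas v -> bmeas (fun o => v (xT o) : R).
  by move=> bv; exact: (bmeas_comp mxT bv).
have bk h : bmeas h -> bmeas (fun o => \int[kernel_prob k (xT o)]_y h y).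
  by move=> bh; exact: (bux _ (bmeas_kernel k bh)).
have step B : measurable B -> \int[P]_o (\1_B (xT o) * f o) =
    \int[P]_o (\1_B (xT o) * \int[kernel_prob k (xT o)]_y f y).
  move=> mB; have bB := bux _ (@bmeas_indic R _ _ _ mB).
  apply/eqP; rewrite -subr_eq0; apply/eqP.
  apply: (@bmeas_functional0 _ _ _ (fun f => \int[P]_o (\1_B (xT o) * f o) -
    \int[P]_o (\1_B (xT o) * \int[kernel_prob k (xT o)]_y f y)) 2) f bf.
  - move=> f1 f2 b1 b2.
    under [X in X - _]eq_Rintegral do rewrite mulrDr.
    rewrite Rint_bmeasD; [|exact: bmeasM|exact: bmeasM].
    under [X in _ - X]eq_Rintegral do rewrite Rint_bmeasD// mulrDr.
    by rewrite Rint_bmeasD; [ring|apply: bmeasM; [|exact: bk]..].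
  - move=> c h b.
    under [X in X - _]eq_Rintegral do rewrite mulrCA.
    rewrite Rint_bmeasZ; last exact: bmeasM.
    under [X in _ - X]eq_Rintegral do rewrite Rint_bmeasZ// mulrCA.
    by rewrite Rint_bmeasZ; [ring|apply: bmeasM; [|exact: bk]].
  - move=> h C b hC.
    have B1 o : `|\1_B (xT o) : R| <= 1.
      by rewrite indicE; case: (_ \in _); rewrite ?normr1 ?normr0.
    rewrite (le_trans (ler_normB _ _))// mulrDl mul1r lerD//.
      apply: normr_Rint_le; first exact: bmeasM.
      by move=> o; rewrite normrM -[leRHS]mul1r ler_pM.
    apply: normr_Rint_le; first by apply: bmeasM => //; exact: bk.
    by move=> o; rewrite normrM -[leRHS]mul1r ler_pM//; exact: normr_Rint_le.
  - move=> A mA; apply/eqP; rewrite subr_eq0; apply/eqP.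
    have mxB : measurable (xT @^-1` B) by rewrite -[X in measurable X]setTI;
      exact: mxT.
    transitivity (fine (P (A `&` xT @^-1` B))).
      rewrite -Rint_indic; last exact: measurableI.
      by apply: eq_Rintegral => o _; rewrite indicI mulrC.
    rewrite hk// /Rintegral [in LHS]integral_mkcond; congr fine.
    apply: eq_integral => o _; rewrite patchE.
    have kf : (k (xT o) A) \is a fin_num.
      by have := @fin_num_measure _ _ _ (kernel_prob k (xT o)) A mA.
    transitivity ((\1_B (xT o))%:E * k (xT o) A)%E; last first.
      rewrite EFinM; congr (_ * _)%E; rewrite -[LHS]fineK//; congr EFin.
      by apply/esym; exact: (@Rint_indic _ _ _ (kernel_prob k (xT o))).
    rewrite indicE; have -> : (xT o \in B) = (o \in xT @^-1` B).
      by apply/idP/idP; rewrite !inE.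
    by case: (_ \in _); rewrite ?mul0e// mul1e.
apply/eqP; rewrite -subr_eq0; apply/eqP.
have [mf [C fC]] := bf.
apply: (@bmeas_functional0 _ _ _ (fun u => \int[P]_o (u (xT o) * f o) -
  \int[P]_o (u (xT o) * \int[kernel_prob k (xT o)]_y f y)) (2 * C)) u bu.
- move=> f1 f2 b1 b2.
  under [X in X - _]eq_Rintegral do rewrite mulrDl.
  rewrite Rint_bmeasD; [|by apply: bmeasM => //; exact: bux..].
  under [X in _ - X]eq_Rintegral do rewrite mulrDl.
  by rewrite Rint_bmeasD; [ring|by apply: bmeasM; [exact: bux|exact: bk]..].
- move=> c h b.
  under [X in X - _]eq_Rintegral do rewrite -mulrA.
  rewrite Rint_bmeasZ; last by apply: bmeasM; first exact: (bux _ b).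
  under [X in _ - X]eq_Rintegral do rewrite -mulrA.
  by rewrite Rint_bmeasZ; [ring|apply: bmeasM; [exact: (bux _ b)|exact: bk]].
- move=> h D b hD.
  rewrite (le_trans (ler_normB _ _))// -mulrA mulrDl mul1r lerD//.
    apply: normr_Rint_le; first by apply: bmeasM; first exact: (bux _ b).
    by move=> o; rewrite normrM mulrC ler_pM.
  apply: normr_Rint_le; first by apply: bmeasM; [exact: (bux _ b)|exact: bk].
  by move=> o; rewrite normrM mulrC ler_pM//; exact: normr_Rint_le.
- by move=> A mA; rewrite step ?subrr.
Qed.

End Disintegration.

(** * Lipschitz dependence on the law *)

Section RealLemmas.
Context (R : realType).
Implicit Types (f df : R -> R).

Lemma is_derive_translate f (s x l : R) :
  is_derive x 1 (fun t => f (s + t)) l <-> is_derive (s + x) 1 f l.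
Proof.
have E : (fun h => h^-1 *: ((f \o shift (s + x)) (h *: (1:R)) - f (s + x))) =
    (fun h => h^-1 *: (((fun t => f (s + t)) \o shift x) (h *: 1) - f (s + x))).
  by apply/funext => h /=; congr (_ *: (f _ - _)); rewrite addrCA.
split=> -[D1 D2]; split.
- by move: D1; rewrite /derivable -E.
- by rewrite -D2 /derive E.
- by move: D1; rewrite /derivable E.
- by rewrite -D2 /derive E.
Qed.

(* (S3) bounds the derivative at each time off a null set that depends on the
   time; [f'] being continuous by (S2), countably many times are enough. *)
Lemma lipschitz_of_rat f (a b L : R) :
  (forall t, a < t < b -> derivable f t 1 /\ derivable f^`()%classic t 1) ->
  (forall q : rat, a < ratr q < b -> `|f^`()%classic (ratr q)| <= L) ->
  forall s t, a < s < b -> a < t < b -> `|f s - f t| <= L * `|s - t|.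
Proof.
move=> df fL.
have f'L x : a < x < b -> `|f^`()%classic x| <= L.
  move=> /andP[ax xb]; rewrite leNgt; apply/negP => Lx.
  have /derivable1_diffP/differentiable_continuous cf' : derivable f^`()%classic x 1.
    by apply: (df x _).2; rewrite ax.
  have dL : 0 < `|f^`()%classic x| - L by rewrite subr_gt0.
  move/cvgrPdist_lt: cf' => /(_ _ dL).
  move=> /nbhs_ballP[e /= e0 He].
  (* A rational in this interval lies both in the domain and so close to x that the derivative there
     still exceeds L. *)
  pose u := Order.max a (x - e); pose v := Order.min b (x + e).
  have : u < v by rewrite /u /v gt_max !lt_min; apply/andP; split; apply/andP;
    split; lra.
  move=> /rat_in_itvoo[q]; rewrite in_itv/= gt_max lt_min => /andP[/andP[aq xq]
    /andP[qb qx]].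
  have := fL q; rewrite aq qb => /(_ isT).
  have := He (ratr q); rewrite /ball/= ltr_norml => H1 H2.
  have {}H1 := H1 _; have := lerB_dist (f^`()%classic x) (f^`()%classic (ratr q)).
  have : `|f^`()%classic x - f^`()%classic (ratr q)| < `|f^`()%classic x| - L.
    by apply: H1; apply/andP; split; lra.
  lra.
have main s t : a < s -> s <= t -> t < b -> `|f t - f s| <= L * (t - s).
  move=> as_ st tb.
  have [c cst ->] : exists2 c, c \in `[s, t]%R & f t - f s =
    f^`()%classic c * (t - s).
    apply: MVT_segment => //.
    - move=> x; rewrite in_itv/= => /andP[sx xt]; rewrite derive1E;
      apply: DeriveDef => //.
      by apply: (df x _).1; lra.
    - apply: derivable_within_continuous => x; rewrite in_itv/= => /andP[sx xt].
      by apply: (df x _).1; lra.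
  move: cst; rewrite in_itv/= => /andP[sc ct].
  rewrite normrM [`|t - s|]ger0_norm ?subr_ge0// ler_wpM2r ?subr_ge0//.
  by apply: f'L; lra.
move=> s t /andP[as_ sb] /andP[at_ tb]; have [st|/ltW ts] := leP s t.
  by rewrite distrC [`|s - t|]distrC [`|t - s|]ger0_norm ?subr_ge0//; exact: main.
by rewrite [`|s - t|]ger0_norm ?subr_ge0//; exact: main.
Qed.

(** The supremum of the times reachable from 0 is itself reachable and can be passed unless it is 1.
    E is an arbitrary relation so that it may be an almost sure inequality: the null sets are united
    two at a time, by [tr]. *)
Lemma local_to_global (E : R -> R -> Prop) :
  (forall s t u, s <= t -> t <= u -> E s t -> E t u -> E s u) ->
  (forall s0, 0 <= s0 <= 1 -> exists2 e : R, 0 < e &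
     forall s t, s <= t -> `|s - s0| < e -> `|t - s0| < e -> E s t) ->
  E 0 1.
Proof.
move=> tr loc.
pose A := [set s : R | 0 <= s <= 1 /\ E 0 s].
have A0 : A 0.
  have [e e0 He] : exists2 e : R, 0 < e &
     forall s t, s <= t -> `|s - 0| < e -> `|t - 0| < e -> E s t.
    by apply: loc; rewrite lexx ler01.
  by split; [rewrite lexx ler01|apply: He; rewrite ?subrr ?normr0].
have sA : has_sup A by split; [exists 0|exists 1 => x [/andP[]]].
have c0 : 0 <= sup A by apply: ub_le_sup => //; case: sA.
have c1 : sup A <= 1 by apply: ge_sup; [exists 0|move=> x [/andP[]]].
have [e e0 He] : exists2 e : R, 0 < e &
    forall s t, s <= t -> `|s - sup A| < e -> `|t - sup A| < e -> E s t.
  by apply: loc; rewrite c0.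
have [a Aa ca] := sup_adherent e0 sA.
have ac : a <= sup A by apply: ub_le_sup => //; case: sA.
case: Aa => /andP[a0 a1] E0a.
(* This time is within e of [sup A], hence reachable; being at most [sup A], it must be 1. *)
pose c' := Order.min 1 (sup A + e / 2).
have cc' : sup A <= c' by rewrite /c' le_min c1 lerDl; lra.
have Ec' : E 0 c'.
  apply: (tr 0 a c') => //; first exact: le_trans cc'.
  apply: He => //; first exact: le_trans cc'.
    by rewrite ltr_norml; apply/andP; split; lra.
  rewrite ger0_norm ?subr_ge0//.
  have : c' <= sup A + e / 2 by rewrite /c' ge_min lexx orbT.
  lra.
have Ac' : A c'.
  by split => //; rewrite (le_trans c0 cc') /c' ge_min lexx.
have c'c : c' <= sup A by apply: ub_le_sup => //; case: sA.
have : c' = 1.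
  by rewrite /c'; case: (leP 1 (sup A + e / 2)) c'c => //; rewrite /c';
    case: leP => //; lra.
by move=> <-.
Qed.
End RealLemmas.

Section Chain.
Context (R : realType) (d : measure_display) (O : measurableType d).
Local Notation law := (probability O R).

Lemma bmeasV (g : O -> R) c : 0 < c -> (forall o, c <= g o) ->
  measurable_fun setT g -> bmeas (fun o => (g o)^-1).
Proof.
move=> c0 cg mg; split; last first.
  exists c^-1 => o; have g0 := lt_le_trans c0 (cg o).
  by rewrite ger0_norm ?invr_ge0 ?(ltW g0)// lef_pV2 ?posrE.
have -> : (fun o => (g o)^-1) = (fun o => expR (- ln (g o))).
  by apply/funext => o; rewrite expRN lnK// posrE (lt_le_trans c0).
apply: measurableT_comp; first exact: measurable_expR.
by apply: measurableT_comp => //; apply: measurableT_comp => //; exact: measurable_ln.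
Qed.

Lemma has_density_chain (P Q Q' : law) f g : bmeas f -> bmeas g ->
  has_density P g Q -> has_density P (fun o => f o * g o) Q' ->
  has_density Q f Q'.
Proof.
move=> bf bg hQ hQ' A mA.
have bA : bmeas (\1_A : O -> R) by exact: bmeas_indic.
have fQ' : Q' A \is a fin_num := fin_num_measure Q' A mA.
have fI : (\int[Q]_(o in A) (f o)%:E)%E \is a fin_num.
  apply: integrable_fin_num => //.
  by apply: (@integrableS _ _ _ _ setT) => //; exact: bmeas_integrable.
rewrite -[LHS]fineK// -[RHS]fineK//; congr EFin.
rewrite hQ'// !fine_Rint_indic// (density_Rint bg hQ); last exact: bmeasM.
by apply: eq_Rintegral => o _; rewrite mulrA.
Qed.
End Chain.

Section Lipschitz.
Context (R : realType) (d : measure_display) (O : measurableType d).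
Local Notation law := (probability O R).
Variables (M : set law) (P0 : law) (T D : law -> O -> R).

(** The derivative is a conditional mean of [D Q * h], and B is the same for all laws of the model.
    The exceptional set is null for Q, the law at which the derivative is taken. *)
Lemma score_derivative_bound (dX : measure_display) (X : measurableType dX)
    (xT : O -> X) (B C : R) (Q : law) (h : O -> R) (Qt : R -> law) :
  S3 M xT T D -> (forall P o, M P -> `|D P o| <= B) -> M Q ->
  bounded_score Q h -> (forall o, `|h o| <= C) ->
  submodel M Q (linear_path h) Qt ->
  {ae Q, forall o, `|(fun t => T (Qt t) o)^`()%classic 0| <= B * C}.
Proof.
move=> [_ /(_ Q)] + hB MQ sh hC sub.
move=> /(_ MQ)[mD [k [_ _ /(_ h Qt sh sub)]]].
apply: filterS => o Ho; rewrite derive1E derive_val.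
apply: (@normr_Rint_le _ _ _ (kernel_prob k (xT o))).
  case: sh => mh _ _; split; first exact: measurable_funM.
  by exists (B * C) => y; rewrite normrM ler_pM// hB.
by move=> y; rewrite normrM ler_pM// hB.
Qed.

Section Path.
Variables (dX : measure_display) (X : measurableType dX) (xT : O -> X) (B : R).
Hypotheses (hS2 : S2 M P0 T) (hS3 : S3 M xT T D)
  (hB : forall P o, M P -> `|D P o| <= B).
Variables (u k : O -> R) (eps : R) (path : R -> law).
Hypotheses (bu : bmeas u) (bk : bmeas k) (k0 : \int[P0]_o k o = 0)
  (keps : forall o, `|k o| <= eps).
Hypothesis small : forall s o, -1 < s < 2 -> `|u o + s * k o| <= 2^-1.
Hypothesis pathP : forall s, -1 < s < 2 ->
  M (path s) /\ has_density P0 (fun o => 1 + (u o + s * k o)) (path s).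

Let g s o := 1 + (u o + s * k o).
(** The score of the path seen from [path s]: since g (s + t) = g s * (1 + t * h s), the path is a
    linear submodel through each of its laws. The bound 1/2 in [small] gives g >= 1/2, hence |h| <=
    2 * eps. *)
Let h s o := k o * (g s o)^-1.

Let g_ge s o : -1 < s < 2 -> 2^-1 <= g s o.
Proof. by move=> s12; have := @small s o s12; rewrite /g ler_norml => /andP[? ?];
  lra. Qed.

Let bg s : bmeas (g s).
Proof.
apply: (@bmeasD _ _ _ (cst 1)); first exact: bmeas_cst.
by apply: bmeasD => //; apply: (@bmeasM _ _ _ (cst s)) => //; exact: bmeas_cst.
Qed.

Let bh s : -1 < s < 2 -> bmeas (h s).
Proof.
move=> s12; apply: bmeasM => //; apply: (@bmeasV _ _ _ _ 2^-1) => //.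
- by move=> o; exact: g_ge.
- by case: (bg s).
Qed.

Let h_le s o : -1 < s < 2 -> `|h s o| <= 2 * eps.
Proof.
move=> s12; rewrite /h normrM mulrC ler_pM//.
have g2 := g_ge o s12; have g0 : 0 < g s o by rewrite (lt_le_trans _ g2).
by rewrite ger0_norm ?invr_ge0 ?(ltW g0)// -[leRHS]invrK lef_pV2 ?posrE.
Qed.

Let score s : -1 < s < 2 -> bounded_score (path s) (h s).
Proof.
move=> s12; have [mh hC] := bh s12; split => //.
have [_ dens] := pathP s12.
rewrite (density_Rint (bg s) dens (bh s12)) -[RHS]k0.
apply: eq_Rintegral => o _; rewrite /h mulfVK//.
by rewrite gt_eqF// (lt_le_trans _ (g_ge o s12)).
Qed.

Let sub s : -1 < s < 2 ->
  submodel M (path s) (linear_path (h s)) (fun t => path (s + t)).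
Proof.
move=> s12; split; first by rewrite addr0.
have [_ dens] := pathP s12.
have st12 : \forall t \near (0 : R), -1 < s + t < 2.
  move: s12 => /andP[s1 s2].
  have e0 : 0 < Order.min (s + 1) (2 - s) by rewrite lt_min; lra.
  near=> t.
  have : `|0 - t| < Order.min (s + 1) (2 - s).
    near: t.
    by exists (Order.min (s + 1) (2 - s)).
  by rewrite sub0r normrN lt_min !ltr_norml => /andP[/andP[? ?] /andP[? ?]]; lra.
near=> t.
have t12 : -1 < s + t < 2 by near: t.
have [Mt denst] := pathP t12; split => //.
apply: (has_density_chain _ (bg s) dens).
  apply: (@bmeasD _ _ _ (cst 1)); first exact: bmeas_cst.
  by apply: (@bmeasM _ _ _ (cst t)); [exact: bmeas_cst|exact: bh].
rewrite (_ : (fun o => _) = (fun o => 1 + (u o + (s + t) * k o)))//.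
apply/funext => o; rewrite /linear_path mulrDl mul1r /h -mulrA mulfVK.
  by rewrite /g; ring.
by rewrite gt_eqF// (lt_le_trans _ (g_ge o s12)).
Unshelve. all: by end_near. Qed.

Let ae_path s (A : O -> Prop) : -1 < s < 2 ->
  {ae path s, forall o, A o} -> {ae P0, forall o, A o}.
Proof.
move=> s12; have [_ dens] := pathP s12.
by apply: (density_ae (bg s) dens (c := 2^-1)) => // o; exact: g_ge.
Qed.

(** (S2) at [path s0] gives one set of full P0-measure on which T is twice differentiable in time
    throughout a neighbourhood of s0. (S3) is then used at the law of each rational time of this
    neighbourhood, and [ae_path] brings its null set back to P0. *)
Let local_lipschitz s0 : -1 < s0 < 2 -> exists2 e : R, 0 < e &
  forall s t, `|s - s0| < e -> `|t - s0| < e ->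
  {ae P0, forall o, `|T (path s) o - T (path t) o| <= B * (2 * eps) * `|s - t|}.
Proof.
move=> s012; have [Ms0 _] := pathP s012.
have [dlt [E [dlt0 mE PE hE]]] := hS2 Ms0 (score s012) (sub s012).
move: (s012) => /andP[s01 s02].
pose e := Order.min dlt (Order.min (s0 + 1) (2 - s0)).
have e0 : 0 < e by rewrite /e !lt_min dlt0; lra.
have e_dlt : e <= dlt by rewrite /e ge_min lexx.
have e_1 : e <= s0 + 1 by rewrite /e !ge_min lexx orbT.
have e_2 : e <= 2 - s0 by rewrite /e !ge_min lexx !orbT.
exists e => // s t se te.
pose f o r := T (path (s0 + r)) o.
have aeE : {ae P0, forall o, E o}.
  exists (~` E); split => //; first exact: measurableC.
  by have := probability_setC P0 mE; rewrite PE subee// => ->.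
have aeq : {ae P0, forall o (q : rat), - e < ratr q < e ->
    `|(f o)^`()%classic (ratr q)| <= B * (2 * eps)}.
  pose G q o := - e < ratr q < e -> `|(f o)^`()%classic (ratr q)| <= B * (2 * eps).
  suff : {ae P0, forall o (n : nat), if unpickle n is Some q then G q o else True}.
    apply: filterS => o Ho q; have := Ho (pickle q); rewrite pickleK; exact.
  apply/ae_foralln => n; case: unpickle => [q|]; last exact: nearW.
  have [qe|qe] := boolP (- e < (ratr q : R) < e); last first.
    by apply: nearW => o; rewrite /G (negbTE qe).
  have q12 : -1 < s0 + ratr q < 2 by lra.
  have [Mq _] := pathP q12.
  have := score_derivative_bound hS3 hB Mq (score q12) (fun o => h_le o q12) (sub
    q12).
  move=> /(ae_path q12); apply: filterS2 aeE => o Eo + _.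
  have [C /(_ o Eo) [df _ _ _]] := hE (ratr q) ltac:(lra).
  have idf : is_derive (ratr q + 0 : R) (1 : R) (f o) ((f o)^`()%classic (ratr q)).
    by rewrite addr0 derive1E; exact/derivableP.
  have {}idf := (is_derive_translate (f o) (ratr q) 0 _).2 idf.
  have <- : (fun t => T (path (s0 + ratr q + t)) o)^`()%classic 0 =
      (f o)^`()%classic (ratr q); last by [].
    rewrite derive1E; apply: derive_val.
    rewrite (_ : (fun t => _) = (fun t => f o (ratr q + t)))//.
    by apply/funext => t'; rewrite /f addrA.
apply: filterS2 aeE aeq => o Eo Hq.
have := @lipschitz_of_rat _ (f o) (- e) e (B * (2 * eps)) _ (Hq) (s - s0) (t - s0).
rewrite /f !(addrC s0) !subrK opprB addrA subrK; apply.
- move=> r /andP[r1 r2].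
  have [C /(_ o Eo) [df ddf _ _]] := hE r ltac:(lra).
  by split.
- by move: se; rewrite ltr_norml.
- by move: te; rewrite ltr_norml.
Qed.

Lemma path_lipschitz :
  {ae P0, forall o, `|T (path 0) o - T (path 1) o| <= B * (2 * eps)}.
Proof.
suff : {ae P0, forall o, `|T (path 0) o - T (path 1) o| <= B * (2 * eps) * (1 - 0)}.
  by apply: filterS => o; rewrite subr0 mulr1.
apply: (@local_to_global _ (fun s t => {ae P0, forall o,
  `|T (path s) o - T (path t) o| <= B * (2 * eps) * (t - s)})).
- move=> r s t rs st; apply: filterS2 => o H1 H2.
  have := ler_distD (T (path s) o) (T (path r) o) (T (path t) o).
  by move=> /le_trans; apply; rewrite (le_trans (lerD H1 H2))//; lra.
- move=> s0 s001; have [e e0 He] := local_lipschitz (s0 := s0) ltac:(lra).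
  exists e => // s t st se te.
  have := He s t se te; apply: filterS => o.
  by rewrite [X in _ <= _ * X -> _]distrC [X in _ <= _ * X -> _]ger0_norm ?subr_ge0//.
Qed.
End Path.
End Lipschitz.

Section ClassS.
Context (R : realType) (d : measure_display) (O : measurableType d).
Local Notation law := (probability O R).
Variables (M : set law) (P0 : law).
Hypotheses (npM : nonparametric M) (MP0 : M P0).

Lemma has_density_self : has_density P0 (fun o => 1 + cst 0 o) P0.
Proof.
move=> A mA; under eq_integral do rewrite addr0.
by rewrite integral_cst// mul1e.
Qed.

Lemma perturbation_score (u : O -> R) (A : law) : bmeas u ->
  has_density P0 (fun o => 1 + u o) A -> bounded_score P0 u.
Proof.
move=> bu hA; have [mu Cu] := bu; split => //.
have b1 := bmeas_cst O (1 : R).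
have := density_total (bmeasD b1 bu) hA.
by rewrite (Rint_bmeasD P0 b1 bu) Rint_cst => ?; lra.
Qed.

(* The path A + s (B - A) is taken over -1 < s < 2 so that 0 and 1 are interior
   times.  It is made to pass through the given laws A and B themselves, since T
   may distinguish laws that agree on all measurable sets. *)
Lemma classS_lipschitz (T D : law -> O -> R) : classS M P0 T D ->
  exists K eta : R, [/\ 0 <= K, 0 < eta &
    forall (u v : O -> R) (A B : law) (eps : R), bmeas u -> bmeas v ->
      has_density P0 (fun o => 1 + u o) A -> has_density P0 (fun o => 1 + v o) B ->
      (forall o, `|u o| <= eta) -> (forall o, `|v o| <= eta) ->
      (forall o, `|v o - u o| <= eps) ->
      {ae P0, forall o, `|T A o - T B o| <= K * eps}].
Proof.
move=> [dX [X [xT [_ _ hS2 hS3]]]].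
have [[B0 hB0] _] := hS3.
have hB P o : M P -> `|D P o| <= `|B0|.
  by move=> MP; rewrite (le_trans (hB0 P o MP))// ler_norm.
have [dlt dlt0 hM] := npM MP0.
(* For -1 < s < 2 both |s| and |1 - s| are at most 2, so u + s * k = (1 - s) * u + s * v is at most
   4 * eta in absolute value: at most 1/2 for [small], and at most dlt to stay in M. *)
pose eta := Order.min 8^-1 (dlt / 4).
have eta8 : eta <= 8^-1 by rewrite /eta ge_min lexx.
have etad : eta <= dlt / 4 by rewrite /eta ge_min lexx orbT.
exists (`|B0| * 2), eta; split; [by rewrite mulr_ge0|by rewrite lt_min; lra|].
move=> u v A B eps bu bv hA hB' ueta veta uv.
pose k o := v o - u o.
have bk : bmeas k by exact: bmeasB.
have [_ _ u0] := perturbation_score bu hA.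
have [_ _ v0] := perturbation_score bv hB'.
have k0 : \int[P0]_o k o = 0 by rewrite Rint_bmeasB// u0 v0 subrr.
have bw s : bmeas (fun o => u o + s * k o).
  by apply: bmeasD => //; apply: (@bmeasM _ _ _ (cst s)) => //; exact: bmeas_cst.
have w_le s o : -1 < s < 2 -> `|u o + s * k o| <= 4 * eta.
  move=> /andP[s1 s2]; rewrite (_ : u o + s * k o = (1 - s) * u o + s * v o);
    last first.
    by rewrite /k; ring.
  rewrite (le_trans (ler_normD _ _))// !normrM.
  have -> : 4 * eta = 2 * eta + 2 * eta by ring.
  by rewrite lerD// ler_pM// ler_norml; apply/andP; split; lra.
have w0 s : \int[P0]_o (u o + s * k o) = 0.
  rewrite Rint_bmeasD//; last first.
    by apply: (@bmeasM _ _ _ (cst s)) => //; exact: bmeas_cst.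
  by rewrite Rint_bmeasZ// u0 k0 mulr0 addr0.
have b1 := bmeas_cst O (1 : R).
have H s : exists Q : law, (-1 < s < 2 -> has_density P0 (fun o => 1 + (u o + s *
  k o)) Q)
    /\ (s = 0 -> Q = A) /\ (s = 1 -> Q = B).
  have [->|s0] := eqVneq s 0.
    exists A; split; last by split => // /eqP; rewrite eq_sym oner_eq0.
    by move=> _; rewrite (_ : (fun o => _) = (fun o => 1 + u o))//;
      apply/funext => o; rewrite mul0r addr0.
  have [->|s1] := eqVneq s 1.
    exists B; split; last by split => // /eqP; rewrite oner_eq0.
    move=> _; rewrite (_ : (fun o => _) = (fun o => 1 + v o))//; apply/funext => o.
    by rewrite /k; ring.
  (* Outside the interval A is a placeholder. *)
  have [s12|s12] := boolP (-1 < s < 2); last first.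
    by exists A; split=> //; split => /eqP; rewrite ?(negbTE s0) ?(negbTE s1).
  have [Q hQ] := @density_exists _ _ _ P0 (fun o => 1 + (u o + s * k o))
    (bmeasD b1 (bw s))
    (fun o => ltac:(have := w_le s o s12; rewrite ler_norml => /andP[? ?]; lra))
    (etrans (Rint_bmeasD P0 b1 (bw s)) ltac:(by rewrite w0 Rint_cst addr0)).
  exists Q; split => //; split => /eqP; by rewrite ?(negbTE s0) ?(negbTE s1).
have {H}[path pathP] := choice H.
have := @path_lipschitz _ _ _ M P0 T D dX X xT `|B0|
  hS2 hS3 hB u k eps path bu bk k0 uv.
have [_ [-> // _]] := pathP 0; have [_ [_ -> //]] := pathP 1.
rewrite -mulrA; apply.
- by move=> s o /w_le; have := eta8 => ? /(_ o); lra.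
- move=> s s12; have [/(_ s12) dens _] := pathP s; split => //.
  apply: (hM (fun o => u o + s * k o)) => //.
    by have [mw Cw] := bw s; split.
  by move=> o; rewrite (le_trans (w_le s o s12))//; lra.
Qed.

End ClassS.

(** * Derivatives along quadratic submodels *)

Section Expansion.
Context (R : realType) (d : measure_display) (O : measurableType d).
Local Notation law := (probability O R).
Variables (M : set law) (P0 : law) (T D : law -> O -> R).
Hypothesis cS : classS M P0 T D.

Lemma classS_bmeas P : M P -> bmeas (T P).
Proof.
move=> MP; have [dX [X [xT [mxT [b b0 /(_ P MP)[tP [mtP TE tb]]] _ _]]]] := cS.
split; last by exists b => o; rewrite TE ler_norml; exact: tb.
rewrite (_ : T P = tP \o xT); last by apply/funext => o; rewrite TE.
exact: measurableT_comp.
Qed.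

Lemma classS_gradient_bmeas P : M P -> bmeas (D P).
Proof.
move=> MP; have [dX [X [xT [_ _ _ [[B hB] /(_ P MP)[mD _]]]]]] := cS.
by split => //; exists B => o; exact: hB.
Qed.

(** [phi (T P o)] is a function of x^T, so D can be replaced by its conditional mean given x^T,
    which is 0 by (S3). *)
Lemma classS_gradient_centered P (phi : R -> R) : M P -> bmeas phi ->
  \int[P]_o (phi (T P o) * D P o) = 0.
Proof.
move=> MP bphi; have bD := classS_gradient_bmeas MP.
have [dX [X [xT [mxT [b b0 /(_ P MP)[tP [mtP TE tb]]] _ [_ /(_ P MP)]]]]] := cS.
move=> [mD [k [ck D0 _]]].
have bu : bmeas (phi \o tP) := bmeas_comp mtP bphi.
rewrite (@eq_Rintegral _ _ _ _ _ (fun o => (phi \o tP) (xT o) * D P o)); last first.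
  by move=> o _; rewrite TE.
rewrite (disintegration mxT ck bu bD) -[RHS](Rint_cst P).
apply: Rint_ae_eq.
- by apply: bmeasM; [exact: (bmeas_comp mxT bu)|exact: (bmeas_comp mxT
  (bmeas_kernel k bD))].
- exact: bmeas_cst.
- by apply: filterS D0 => o;
  rewrite -[Rintegral _ _ _]/(Rintegral (kernel_prob k (xT o)) _ _) => ->;
    rewrite mulr0.
Qed.

(** Here g is the conditional mean of [D P0 * h1] given x^T, which is the derivative in (S3); the
    identity with phi is its disintegration, [phi (T P0 o)] being a function of x^T. Times run
    through a sequence because the Lipschitz bound excludes a null set for each time. *)
Lemma classS_expansion (h1 h2 : O -> R) (Pt : R -> law) :
  nonparametric M -> M P0 ->
  bounded_score P0 h1 -> bounded_score P0 h2 ->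
  submodel M P0 (quadratic_path h1 h2) Pt ->
  exists (C a : R) (g : O -> R), [/\ 0 < a, bmeas g,
    forall phi : R -> R, bmeas phi ->
      \int[P0]_o (phi (T P0 o) * g o) = \int[P0]_o (phi (T P0 o) * (D P0 o * h1 o))
  & forall t : nat -> R, (forall n, `|t n| < a) -> (forall n, t n != 0) ->
      t n @[n --> \oo] --> 0 ->
      {ae P0, forall o n, `|T (Pt (t n)) o - T P0 o| <= C * `|t n|} /\
      {ae P0, forall o, (t n)^-1 * (T (Pt (t n)) o - T P0 o) @[n --> \oo] --> g o}].
Proof.
move=> npM MP0 s1 s2 [Pt0 sub].
have [K [eta [K0 eta0 lipT]]] := classS_lipschitz npM MP0 cS.
have [dlt dlt0 hM] := npM P0 MP0.
have bD := classS_gradient_bmeas MP0.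
have [dX [X [xT [mxT [b b0 /(_ P0 MP0)[tP [mtP TE tb]]] _ [_ /(_ P0 MP0)]]]]] := cS.
move=> [mD [k [ck _ drv]]].
have [mh1 [C1 hC1] h10] := s1; have [mh2 [C2 hC2] h20] := s2.
have bh1 : bmeas h1 by split => //; exists C1.
have bh2 : bmeas h2 by split => //; exists C2.
pose c := `|C1| + `|C2| + 1.
have c0 : 0 < c by rewrite ltr_wpDl ?addr_ge0.
have C1c o : `|h1 o| <= c.
  by rewrite (le_trans (hC1 o))// (le_trans (ler_norm _))// /c -addrA lerDl addr_ge0.
have C2c o : `|h2 o| <= c.
  by rewrite (le_trans (hC2 o))// (le_trans (ler_norm _))// /c addrAC lerDr addr_ge0.
have C12c o : `|h1 o| + `|h2 o| <= c.
  rewrite (le_trans (lerD (hC1 o) (hC2 o)))// /c.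
  by have := ler_norm C1; have := ler_norm C2; lra.
have [r /= r0 hr] : exists2 r : R, 0 < r & forall t, `|t| < r ->
    M (Pt t) /\ has_density P0 (quadratic_path h1 h2 t) (Pt t).
  move: sub => [r /= r0 hr]; exists r => // t tr.
  by apply: hr; rewrite /= sub0r normrN.
(* The bounds serve the Lipschitz estimate (eta), the positivity of 1 + s * h1 (1/2) and membership
   in M (dlt). In a below, r is the range of the submodel and 1 gives t^2 <= |t|. *)
pose m := Order.min eta (Order.min 2^-1 dlt).
have m0 : 0 < m by rewrite !lt_min eta0 dlt0 invr_gt0 ltr0n.
pose a := Order.min r (Order.min 1 (m / c)).
have a0 : 0 < a by rewrite /a !lt_min r0 ltr01 divr_gt0.
have tm t x : `|t| < a -> `|x| <= c -> `|t * x| <= m.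
  move=> ta xc; rewrite normrM.
  have tmc : `|t| <= m / c.
    by rewrite (le_trans (ltW ta))// /a !ge_min lexx !orbT.
  by rewrite (le_trans (ler_pM _ _ tmc xc))// divfK// gt_eqF.
have m_eta : m <= eta by rewrite /m ge_min lexx.
have m_2 : m <= 2^-1 by rewrite /m !ge_min lexx orbT.
have m_d : m <= dlt by rewrite /m !ge_min lexx !orbT.
have bZ x (f : O -> R) : bmeas f -> bmeas (fun o => x * f o).
  by move=> bf; apply: (@bmeasM _ _ _ (cst x)) => //; exact: bmeas_cst.
have b1 := bmeas_cst O (1 : R).
(* (S3) differentiates T along the linear path [Q]; the densities of [Pt t] and
   [Q t] differ by t^2 h2, hence so do T (Pt t) and T (Q t), up to a constant. *)
have H s : exists Q : law, (`|s| < a -> M Q /\ has_density P0 (linear_path h1 s) Q)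
    /\ (s = 0 -> Q = P0).
  have [->|s0] := eqVneq s 0.
    exists P0; split => // _; split => //.
    rewrite (_ : linear_path h1 0 = (fun o => 1 + cst 0 o));
      first exact: has_density_self.
    by apply/funext => o; rewrite /linear_path mul0r.
  have [sa|sa] := boolP (`|s| < a); last by exists P0; split => // /eqP;
    rewrite (negbTE s0).
  have i1 : \int[P0]_o (1 + s * h1 o) = 1.
    by rewrite (Rint_bmeasD P0 b1 (bZ s _ bh1)) Rint_bmeasZ//
      h10 Rint_cst mulr0 addr0.
  have [Q hQ] := @density_exists _ _ _ P0 (fun o => 1 + s * h1 o)
    (bmeasD b1 (bZ s _ bh1))
    (fun o => ltac:(have := tm _ _ sa (C1c o); rewrite ler_norml => /andP[? ?]; lra))
    i1.
  exists Q; split=> [_|/eqP]; last by rewrite (negbTE s0).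
  split => //; apply: (hM (fun o => s * h1 o) Q) => //.
    exact: perturbation_score (bZ s _ bh1) hQ.
  by move=> o; rewrite (le_trans (tm _ _ sa (C1c o))).
have {H}[Q QP] := choice H.
have subQ : submodel M P0 (linear_path h1) Q.
  split; first by have [_ ->] := QP 0.
  exists a => //= t; rewrite /= sub0r normrN => ta.
  by have [/(_ ta)] := QP t.
pose g o := \int[kernel_prob k (xT o)]_y (D P0 y * h1 y).
have bDh : bmeas (fun y => D P0 y * h1 y) by exact: bmeasM.
have quadE t : quadratic_path h1 h2 t = (fun o => 1 + (t * h1 o + t ^+ 2 * h2 o)).
  by apply/funext => o; rewrite /quadratic_path addrA.
have bq t : bmeas (fun o => t * h1 o + t ^+ 2 * h2 o).
  by apply: bmeasD; exact: bZ.
have q_le t o : `|t| < a -> `|t * h1 o + t ^+ 2 * h2 o| <= `|t| * c.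
  move=> ta; rewrite expr2 -mulrA -mulrDr normrM ler_wpM2l//.
  rewrite (le_trans (ler_normD _ _))// (le_trans _ (C12c o))// lerD2l.
  rewrite normrM -[leRHS]mul1r ler_wpM2r//.
  by rewrite (le_trans (ltW ta))// /a !ge_min lexx orbT.
have q_eta t o : `|t| < a -> `|t * h1 o + t ^+ 2 * h2 o| <= eta.
  move=> ta; rewrite (le_trans (q_le _ _ ta))// (le_trans _ m_eta)//.
  have := tm t c ta; rewrite normrM (gtr0_norm c0); exact.
exists (K * c), a, g; split => //.
- exact: (bmeas_comp mxT (bmeas_kernel k bDh)).
- move=> phi bphi.
  rewrite (@eq_Rintegral _ _ _ _ _ (fun o => (phi \o tP) (xT o) * g o)); last first.
    by move=> o _; rewrite TE.
  rewrite -(disintegration mxT ck (bmeas_comp mtP bphi) bDh).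
  by apply: eq_Rintegral => o _; rewrite TE.
- move=> t ta tn0 t0; split.
    apply/ae_foralln => n; have [Mn dn] :=
      hr (t n) ltac:(by rewrite (lt_le_trans (ta n))// /a ge_min lexx).
    rewrite quadE in dn.
    have := lipT _ (cst 0) (Pt (t n)) P0 (`|t n|
      * c) (bq (t n)) (bmeas_cst _ 0) dn (@has_density_self _ _ _ P0).
    have -> : K * c * `|t n| = K * (`|t n| * c) by ring.
    apply.
    + by move=> o; apply: q_eta.
    + by move=> o; rewrite normr0 ltW.
    + by move=> o; rewrite sub0r normrN q_le.
  have ae1 : {ae P0, forall o n, `|T (Pt (t n)) o - T (Q (t n)) o| <= K * (`|t n|
    ^+ 2 * c)}.
    apply/ae_foralln => n; have [Mn dn] :=
      hr (t n) ltac:(by rewrite (lt_le_trans (ta n))// /a ge_min lexx).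
    rewrite quadE in dn.
    have [/(_ (ta n))[_ dQ] _] := QP (t n).
    apply: (lipT _ (fun o => t n * h1 o) (Pt (t n)) (Q (t n)) _ (bq (t n)) (bZ _
      _ bh1) dn dQ).
    + by move=> o; apply: q_eta.
    + by move=> o; rewrite (le_trans (tm _ _ (ta n) (C1c o))).
    + by move=> o; rewrite opprD addrA subrr sub0r normrN normrM normrX
      ler_wpM2l// exprn_ge0.
  apply: filterS2 ae1 (drv h1 Q s1 subQ) => o H1 H2.
  rewrite (_ : (fun n => _) = (fun n => (t n)^-1 * (T (Pt (t n)) o - T (Q (t n)) o) +
     (t n)^-1 * (T (Q (t n)) o - T P0 o))); last by apply/funext => n; ring.
  rewrite -[g o]add0r; apply: cvgD.
    apply/norm_cvg0P.
    apply: (@squeeze_cvgr _ _ _ _ (cst 0) (fun n => K * c * `|t n|)).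
    + apply: nearW => n; rewrite normr_ge0/= normrM normfV mulrC ler_pdivrMr
      ?normr_gt0//.
      rewrite (le_trans (H1 n))// (_ : K * (_ * c) = K * c * `|t n| * `|t n|)//; ring.
    + exact: cvg_cst.
    + rewrite -(mulr0 (K * c)) -(normr0 R); apply: cvgMr; exact: cvg_norm.
  have [df dE] := H2.
  have : (fun x => x^-1 *: (((fun t => T (Q t) o) \o shift 0) (x *: (1:R)) - T (Q
    0) o)) @ 0^'
     --> g o.
    by rewrite /g -[Rintegral _ _ _]/(Rintegral (k (xT o)) _ _) -dE; exact: df.
  move=> /cvgr_dnbhsP/(_ t (conj tn0 t0)).
  rewrite (_ : (fun n => _) = (fun n => (t n)^-1 * (T (Q (t n)) o - T P0 o)))//.
  apply/funext => n /=; congr (_ * (T (Q _) o - T _ o)).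
    by rewrite addr0 /GRing.scale/= mulr1.
  by have [_ ->] := QP 0.
Qed.
End Expansion.

(** * Mixed second differences of the Gaussian kernel *)

Section Gauss.
Context (R : realType).
Implicit Types (u a b x y : R).

Definition gauss u : R := expR (- u ^+ 2).
Definition dgauss u : R := - (2 * u) * gauss u.
Definition d2gauss u : R := (4 * u ^+ 2 - 2) * gauss u.

Lemma is_derive_gauss x : is_derive x 1 gauss (dgauss x).
Proof.
have h : is_derive x (1:R) (fun u : R => - u ^+ 2) (- (2 * x)).
  apply: is_derive_eq; rewrite /GRing.scale/=; ring.
have := @is_derive1_comp R expR (fun u => - u ^+ 2) x _ _ (is_derive_expR _) h.
by rewrite /dgauss /gauss mulrC.
Qed.

Lemma is_derive_dgauss x : is_derive x 1 dgauss (d2gauss x).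
Proof.
have h := is_derive_gauss x.
rewrite /dgauss; apply: is_derive_eq.
rewrite /GRing.scale/= /dgauss /d2gauss; ring.
Qed.

Lemma continuous_gauss : continuous gauss.
Proof.
move=> x; apply/differentiable_continuous/derivable1_diffP.
by have [] := is_derive_gauss x.
Qed.

Lemma continuous_dgauss : continuous dgauss.
Proof.
move=> x; apply/differentiable_continuous/derivable1_diffP.
by have [] := is_derive_dgauss x.
Qed.

Lemma continuous_d2gauss : continuous d2gauss.
Proof.
move=> x; apply: cvgM; last exact: continuous_gauss.
apply: cvgB; last exact: cvg_cst.
by apply: cvgM; [exact: cvg_cst|exact: exprn_continuous].
Qed.

(** The last bound is 1 + x^2 <= exp (x^2); the bounds on the two derivatives follow from these
    three. *)
Lemma gauss_bounds x : [/\ 0 <= gauss x, gauss x <= 1 & x ^+ 2 * gauss x <= 1].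
Proof.
have g0 : 0 < gauss x by exact: expR_gt0.
split; first exact: ltW.
- by rewrite /gauss -expR0 ler_expR oppr_le0 sqr_ge0.
- have : (1 + x ^+ 2) * gauss x <= 1.
    by rewrite /gauss expRN ler_pdivrMr ?expR_gt0// mul1r expR_ge1Dx.
  by move: g0; rewrite mulrDl mul1r; lra.
Qed.

Lemma normr_gauss x : `|gauss x| <= 1.
Proof. by have [? ? _] := gauss_bounds x; rewrite ger0_norm. Qed.

Lemma normr_dgauss x : `|dgauss x| <= 2.
Proof.
have [g0 g1 xg] := gauss_bounds x; rewrite /dgauss.
have h : `|x| * gauss x <= 1.
  have [x1|/ltW x1] := leP `|x| 1; first by rewrite -[leRHS]mul1r ler_pM.
  rewrite (le_trans _ xg)// -[x ^+ 2]real_normK ?num_real// ler_wpM2r// expr2.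
  by rewrite ler_peMr.
by rewrite normrM normrN normrM (ger0_norm g0) ger0_norm// -mulrA; lra.
Qed.

Lemma normr_d2gauss x : `|d2gauss x| <= 6.
Proof.
have [g0 g1 xg] := gauss_bounds x; rewrite /d2gauss mulrBl -mulrA.
have : 0 <= x ^+ 2 * gauss x by rewrite mulr_ge0// sqr_ge0.
by rewrite ler_norml => ?; apply/andP; split; lra.
Qed.

(** The intermediate point is given by its offset c from x, which covers both signs of a and shows
    that c vanishes with a. *)
Lemma mvt_shift (f f' : R -> R) : (forall x, is_derive x 1 f (f' x)) ->
  forall x a, exists2 c : R, `|c| <= `|a| & f (x + a) - f x = a * f' (x + c).
Proof.
move=> df x a.
have cf p q : {within `[p, q], continuous f}.
  by apply: derivable_within_continuous => y _; have [] := df y.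
have [a0|/ltW a0] := leP 0 a.
  have [c] := @MVT_segment _ f f' x (x + a) ltac:(by rewrite lerDl) (fun y _ =>
    df y) (cf _ _).
  rewrite in_itv/= => /andP[xc cx] E; exists (c - x).
    by rewrite !ger0_norm//; lra.
  by rewrite E addrAC subrr add0r mulrC [x + _]addrC subrK.
have [c] := @MVT_segment _ f f' (x + a) x ltac:(by rewrite gerDl) (fun y _ => df
  y) (cf _ _).
rewrite in_itv/= => /andP[xc cx] E; exists (c - x).
  by rewrite !ler0_norm//; lra.
by rewrite -opprB E [x + (_ - _)]addrC subrK; ring.
Qed.

Definition mixed_diff (p q x y x0 y0 : R) : R :=
  p * q * gauss (x - y) - p * gauss (x - y0) - q * gauss (x0 - y) + gauss (x0 - y0).

(* (p, x) and (q, y) move from (1, x0) and (1, y0); the mean value theorem is used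
   once for each coordinate that moves inside [gauss]. *)
Lemma mixed_diffE p q x y x0 y0 : let u := x0 - y0 in let a := x - x0 in let b :=
  y0 - y in
  exists c : R * R * R,
  [/\ `|c.1.1| <= `|a| + `|b|, `|c.1.2| <= `|a| + `|b|, `|c.2| <= `|a| + `|b| &
   mixed_diff p q x y x0 y0 = (p - 1) * (q - 1) * gauss (u + (a + b)) +
     (p - 1) * b * dgauss (u + c.1.1) + (q - 1) * a * dgauss (u + c.1.2)
     + a * b * d2gauss (u + c.2)].
Proof.
move=> u a b.
have [c1 c1b E1] := mvt_shift is_derive_gauss (u + a) b.
have [c2 c2a E2] := mvt_shift is_derive_gauss (u + b) a.
(* When both coordinates move, the first mean value is taken for this difference of two translates;
   its derivative is an increment of [dgauss], to which the second applies. *)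
have D3 (z : R) : is_derive z (1 : R) (fun s => gauss (b + s) - gauss s) (dgauss
  (b + z) - dgauss z).
  have := is_derive_gauss z.
  have := (is_derive_translate gauss b z _).2 (is_derive_gauss (b + z)).
  by move=> ? ?; apply: is_deriveB.
have [c3 c3a E3] := mvt_shift D3 u a.
have [c4 c4b E4] := mvt_shift is_derive_dgauss (u + c3) b.
exists (a + c1, b + c2, c3 + c4); split => /=.
- by rewrite (le_trans (ler_normD _ _))// lerD2l.
- by rewrite (le_trans (ler_normD _ _))// addrC lerD2r.
- by rewrite (le_trans (ler_normD _ _))// lerD.
rewrite /mixed_diff.
rewrite -/u.
have -> : x - y = u + (a + b) by rewrite /u /a /b; ring.
have -> : x - y0 = u + a by rewrite /u /a; ring.
have -> : x0 - y = u + b by rewrite /u /b; ring.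
clearbody u a b.
have F1 : gauss (u + (a + b)) - gauss (u + a) = b * dgauss (u + (a + c1)).
  by rewrite !addrA; exact: E1.
have F2 : gauss (u + (a + b)) - gauss (u + b) = a * dgauss (u + (b + c2)).
  by rewrite [a + b]addrC !addrA; exact: E2.
have F3 : (gauss (u + (a + b)) - gauss (u + a)) - (gauss (u + b) - gauss u) =
    a * (b * d2gauss (u + (c3 + c4))).
  have -> : u + (c3 + c4) = u + c3 + c4 by rewrite addrA.
  rewrite -E4; move: E3 => /=.
  have -> : b + (u + a) = u + (a + b) by ring.
  have -> : b + u = u + b by ring.
  by have -> : b + (u + c3) = u + c3 + b by ring.
have -> : (p - 1) * b * dgauss (u + (a + c1)) =
    (p - 1) * (gauss (u + (a + b)) - gauss (u + a)) by rewrite F1 mulrA.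
have -> : (q - 1) * a * dgauss (u + (b + c2)) =
    (q - 1) * (gauss (u + (a + b)) - gauss (u + b)) by rewrite F2 mulrA.
rewrite -[a * b * _]mulrA -F3; ring.
Qed.
End Gauss.

Section MixedLimit.
Context (R : realType).

(** Each of the four terms of [mixed_diffE] has two factors of size at most C * |t|, and 11 = 1 + 2
    + 2 + 6 adds the bounds of [gauss], [dgauss] (twice) and [d2gauss]. *)
Lemma mixed_diff_bound (t C p q x y x0 y0 : R) :
  `|p - 1| <= C * `|t| -> `|q - 1| <= C * `|t| ->
  `|x - x0| <= C * `|t| -> `|y - y0| <= C * `|t| ->
  `|mixed_diff p q x y x0 y0| <= 11 * C ^+ 2 * t ^+ 2.
Proof.
move=> hp hq hx; rewrite distrC => hy.
have [c [_ _ _ ->]] := mixed_diffE p q x y x0 y0.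
have t2 : t ^+ 2 = `|t| ^+ 2 by rewrite real_normK// num_real.
have P (a b g k : R) : `|a| <= C * `|t| -> `|b| <= C * `|t| -> `|g| <= k ->
    `|a * b * g| <= k * (C ^+ 2 * t ^+ 2).
  move=> ha hb hg; rewrite !normrM mulrC ler_pM//.
  have -> : C ^+ 2 * t ^+ 2 = (C * `|t|) * (C * `|t|) by rewrite t2; ring.
  by rewrite ler_pM.
have -> : 11 * C ^+ 2 * t ^+ 2 = 1 * (C ^+ 2 * t ^+ 2) + 2 * (C ^+ 2 * t ^+ 2)
  + 2 * (C ^+ 2 * t ^+ 2) + 6 * (C ^+ 2 * t ^+ 2) by ring.
rewrite (le_trans (ler_normD _ _))// lerD//; last by apply: P => //;
  exact: normr_d2gauss.
rewrite (le_trans (ler_normD _ _))// lerD//; last by apply: P => //;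
  exact: normr_dgauss.
rewrite (le_trans (ler_normD _ _))// lerD//; last by apply: P => //;
  exact: normr_dgauss.
by apply: P => //; exact: normr_gauss.
Qed.

(** The mixed derivative of p(s) q(t) gauss (x(s) - y(t)) in s and t at p = q = 1, where x, y, p, q
    have velocities xi, eta, al, be; the minus signs come from y. *)
Definition mixed_limit (x0 y0 xi eta al be : R) : R :=
  al * be * gauss (x0 - y0) - al * eta * dgauss (x0 - y0)
  + be * xi * dgauss (x0 - y0) - xi * eta * d2gauss (x0 - y0).

Lemma cvg_of_quotient (t x : nat -> R) (x0 xi : R) : (forall n, t n != 0) ->
  t n @[n --> \oo] --> 0 -> (t n)^-1 * (x n - x0) @[n --> \oo] --> xi ->
  x n - x0 @[n --> \oo] --> 0.
Proof.
move=> tn0 t0 cx; rewrite -(mul0r xi).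
rewrite (_ : (fun n => _) = (fun n => t n * ((t n)^-1 * (x n - x0))));
  first exact: cvgM.
by apply/funext => n; rewrite mulVKf.
Qed.

(** In [mixed_diffE] each of the two increments of a term takes one factor 1 / t, and the
    intermediate points tend to x0 - y0. *)
Lemma mixed_diff_cvg (t p q x y : nat -> R) (x0 y0 xi eta al be : R) :
  (forall n, t n != 0) -> t n @[n --> \oo] --> 0 ->
  (t n)^-1 * (p n - 1) @[n --> \oo] --> al -> (t n)^-1 * (q n - 1) @[n --> \oo]
    --> be ->
  (t n)^-1 * (x n - x0) @[n --> \oo] --> xi -> (t n)^-1 * (y n - y0) @[n --> \oo]
    --> eta ->
  (t n ^+ 2)^-1 * mixed_diff (p n) (q n) (x n) (y n) x0 y0 @[n --> \oo]
    --> mixed_limit x0 y0 xi eta al be.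
Proof.
move=> tn0 t0 cp cq cx cy.
have /choice[c cP] n := mixed_diffE (p n) (q n) (x n) (y n) x0 y0.
have cxy : `|x n - x0| + `|y0 - y n| @[n --> \oo] --> (0 : R).
  rewrite -[0]addr0 -(normr0 R); apply: cvgD; apply: cvg_norm.
    exact: cvg_of_quotient cx.
  rewrite -oppr0 (_ : (fun n => y0 - y n) = (fun n => - (y n - y0))).
    apply: cvgN; exact: cvg_of_quotient cy.
  by apply/funext => n; rewrite opprB.
have small (e : nat -> R) : (forall n, `|e n| <= `|x n - x0| + `|y0 - y n|) ->
    (x0 - y0) + e n @[n --> \oo] --> x0 - y0.
  move=> he; rewrite -[X in _ --> X]addr0; apply: cvgD; first exact: cvg_cst.
  apply/norm_cvg0P; apply: (@squeeze_cvgr _ _ _ _ (cst 0) _ _ _ _ _ cxy).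
    by apply: nearW => n; rewrite normr_ge0 he.
  exact: cvg_cst.
have cK (K : R -> R) e : continuous K -> (forall n, `|e n| <= `|x n - x0|
  + `|y0 - y n|) ->
    K ((x0 - y0) + e n) @[n --> \oo] --> K (x0 - y0).
  by move=> contK he; exact: (cvg_comp _ _ (small e he) (contK _)).
rewrite (_ : (fun n => _) = (fun n =>
   ((t n)^-1 * (p n - 1)) * ((t n)^-1 * (q n - 1)) * gauss (x0 - y0 + ((x n - x0)
     + (y0 - y n)))
   - ((t n)^-1 * (p n - 1)) * ((t n)^-1 * (y n - y0)) * dgauss (x0 - y0 + (c n).1.1)
   + ((t n)^-1 * (q n - 1)) * ((t n)^-1 * (x n - x0)) * dgauss (x0 - y0 + (c n).1.2)
   - ((t n)^-1 * (x n - x0)) * ((t n)^-1 * (y n - y0)) * d2gauss (x0 - y0 + (c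
     n).2))).
  rewrite /mixed_limit; apply: cvgB; [apply: cvgD; [apply: cvgB|]|].
  - apply: cvgM; first exact: cvgM.
    by apply: cK; [exact: continuous_gauss|move=> n; exact: ler_normD].
  - apply: cvgM; first exact: cvgM.
    by apply: cK; [exact: continuous_dgauss|move=> n; case: (cP n)].
  - apply: cvgM; first exact: cvgM.
    by apply: cK; [exact: continuous_dgauss|move=> n; case: (cP n)].
  - apply: cvgM; first exact: cvgM.
    by apply: cK; [exact: continuous_d2gauss|move=> n; case: (cP n)].
by apply/funext => n; case: (cP n) => _ _ _ ->; rewrite expr2 invfM; ring.
Qed.
End MixedLimit.

Section BmeasGauss.
Context (R : realType) (d : measure_display) (T : measurableType d).

Lemma bmeas_gauss (f : T -> R) : measurable_fun setT f -> bmeas (fun z => gauss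
  (f z)).
Proof.
move=> mf; split; last by exists 1 => z; exact: normr_gauss.
rewrite /gauss.
apply: measurableT_comp; first exact: measurable_expR.
by apply: measurableT_comp => //; exact: measurable_funX.
Qed.

Lemma bmeas_dgauss (f : T -> R) : measurable_fun setT f -> bmeas (fun z => dgauss
  (f z)).
Proof.
move=> mf; split; last by exists 2 => z; exact: normr_dgauss.
apply: measurable_funM; last by case: (bmeas_gauss mf).
by apply: measurableT_comp => //; apply: measurable_funM.
Qed.

Lemma bmeas_d2gauss (f : T -> R) : measurable_fun setT f -> bmeas (fun z =>
  d2gauss (f z)).
Proof.
move=> mf; split; last by exists 6 => z; exact: normr_d2gauss.
apply: measurable_funM; last by case: (bmeas_gauss mf).
by apply: measurable_funB => //; apply: measurable_funM => //; exact: measurable_funX.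
Qed.
End BmeasGauss.

Section MixedLimitSwap.
Context (R : realType) (d : measure_display) (O : measurableType d) (P :
  probability O R).
Variables (T U gT gU h : O -> R).
Hypotheses (bT : bmeas T) (bU : bmeas U) (bgT : bmeas gT) (bgU : bmeas gU) (bh :
  bmeas h).

Let PP := (P \x P)%E.

Lemma bmeas_fst (f : O -> R) : bmeas f -> bmeas (fun z : O * O => f z.1).
Proof. by move=> bf; exact: (bmeas_comp measurable_fst bf). Qed.

Lemma bmeas_snd (f : O -> R) : bmeas f -> bmeas (fun z : O * O => f z.2).
Proof. by move=> bf; exact: (bmeas_comp measurable_snd bf). Qed.

Let mTU : measurable_fun setT (fun z : O * O => T z.1 - U z.2).
Proof. by case: (bmeasB (bmeas_fst bT) (bmeas_snd bU)). Qed.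

Lemma bmeas_mixed_limit (f1 f2 : O -> R) : bmeas f1 -> bmeas f2 ->
  bmeas (fun z : O * O => mixed_limit (T z.1) (U z.2) (f1 z.1) (f2 z.2) (h z.1)
    (h z.2)).
Proof.
move=> bf1 bf2.
have := (bmeas_fst bh, bmeas_snd bh, bmeas_fst bf1, bmeas_snd bf2).
move=> [[[b1 b2] b3] b4].
have g0 := bmeas_gauss mTU; have g1 := bmeas_dgauss mTU; have g2 := bmeas_d2gauss mTU.
by rewrite /mixed_limit; apply: bmeasB; [apply: bmeasD; [apply: bmeasB|]|];
  do 2!apply: bmeasM => //.
Qed.

(** For fixed o2 the integrand is affine in f1, with coefficient phi (T o1); only the integrals of
    f1 against functions of T matter. *)
Lemma mixed_limit_swapl (f1 f1' f2 : O -> R) : bmeas f1 -> bmeas f1' -> bmeas f2 ->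
  (forall phi : R -> R, bmeas phi ->
     \int[P]_o (phi (T o) * f1 o) = \int[P]_o (phi (T o) * f1' o)) ->
  \int[PP]_z mixed_limit (T z.1) (U z.2) (f1 z.1) (f2 z.2) (h z.1) (h z.2) =
  \int[PP]_z mixed_limit (T z.1) (U z.2) (f1' z.1) (f2 z.2) (h z.1) (h z.2).
Proof.
move=> b1 b1' b2 H.
rewrite -(Rint_fubini2 P P (bmeas_mixed_limit b1 b2)).
rewrite -(Rint_fubini2 P P (bmeas_mixed_limit b1' b2)).
apply: eq_Rintegral => o2 _ /=.
pose phi x := h o2 * dgauss (x - U o2) - f2 o2 * d2gauss (x - U o2).
have mx : measurable_fun setT (fun x : R => x - U o2) by exact: measurable_funB.
have bphi : bmeas phi.
  by apply: bmeasB; (apply: (@bmeasM _ _ _ (cst _)); first exact: bmeas_cst);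
    [exact: bmeas_dgauss|exact: bmeas_d2gauss].
pose A o := h o * (h o2 * gauss (T o - U o2) - f2 o2 * dgauss (T o - U o2)).
have mTo : measurable_fun setT (fun o => T o - U o2).
  by case: bT => mT _; exact: measurable_funB.
have bA : bmeas A.
  apply: bmeasM => //; apply: bmeasB; (apply: (@bmeasM _ _ _ (cst _));
    first exact: bmeas_cst).
    exact: bmeas_gauss.
  exact: bmeas_dgauss.
have bphiT f : bmeas f -> bmeas (fun o => phi (T o) * f o).
  by move=> bf; apply: bmeasM => //; exact: (bmeas_comp bT.1 bphi).
have E f : bmeas f -> \int[P]_o mixed_limit (T o) (U o2) (f o) (f2 o2) (h o) (h o2) =
    \int[P]_o A o + \int[P]_o (phi (T o) * f o).
  move=> bf; rewrite -Rint_bmeasD//; last exact: bphiT.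
  by apply: eq_Rintegral => o _; rewrite /mixed_limit /phi /A; ring.
by rewrite !E// H.
Qed.
End MixedLimitSwap.

Lemma dgaussN (R : realType) (u : R) : dgauss (- u) = - dgauss u.
Proof. by rewrite /dgauss /gauss sqrrN; ring. Qed.

Lemma mixed_limitC (R : realType) (x y xi eta al be : R) :
  mixed_limit x y xi eta al be = mixed_limit y x eta xi be al.
Proof.
rewrite /mixed_limit -(opprB x y) dgaussN /gauss /d2gauss /gauss !sqrrN; ring.
Qed.

Section PairLimit.
Context (R : realType) (d : measure_display) (O : measurableType d) (P :
  probability O R).
Variables (T U gT gU h : O -> R).
Hypotheses (bT : bmeas T) (bU : bmeas U) (bgT : bmeas gT) (bgU : bmeas gU) (bh :
  bmeas h).

Let PP := (P \x P)%E.

(** Exchanging the two observations, by Fubini and [mixed_limitC], reduces this to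
    [mixed_limit_swapl]. *)
Lemma mixed_limit_swapr (f1 f2 f2' : O -> R) : bmeas f1 -> bmeas f2 -> bmeas f2' ->
  (forall phi : R -> R, bmeas phi ->
     \int[P]_o (phi (U o) * f2 o) = \int[P]_o (phi (U o) * f2' o)) ->
  \int[PP]_z mixed_limit (T z.1) (U z.2) (f1 z.1) (f2 z.2) (h z.1) (h z.2) =
  \int[PP]_z mixed_limit (T z.1) (U z.2) (f1 z.1) (f2' z.2) (h z.1) (h z.2).
Proof.
move=> b1 b2 b2' H; have b := @bmeas_mixed_limit R d O.
rewrite -(Rint_fubini1 P P (b T U h bT bU bh f1 f2 b1 b2)).
rewrite -(Rint_fubini1 P P (b T U h bT bU bh f1 f2' b1 b2')) /=.
have bUT f (bf : bmeas f) := b U T h bU bT bh f f1 bf b1.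
have E f : bmeas f -> \int[P]_x \int[P]_y mixed_limit (T x) (U y) (f1 x) (f y) (h
  x) (h y) =
   \int[PP]_z mixed_limit (U z.1) (T z.2) (f z.1) (f1 z.2) (h z.1) (h z.2).
  move=> bf; rewrite -(Rint_fubini2 P P (bUT f bf))/=.
  by apply: eq_Rintegral => x _; apply: eq_Rintegral => y _; rewrite mixed_limitC.
by rewrite !E//; exact: mixed_limit_swapl.
Qed.

Lemma pair_limit (t : nat -> R) (p Tn Un : nat -> O -> R) (C : R) :
  (forall n, t n != 0) -> t n @[n --> \oo] --> 0 ->
  (forall n, bmeas (p n)) -> (forall n, bmeas (Tn n)) -> (forall n, bmeas (Un n)) ->
  (forall n o, `|p n o - 1| <= C * `|t n|) ->
  (forall o, (t n)^-1 * (p n o - 1) @[n --> \oo] --> h o) ->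
  {ae P, forall o n, `|Tn n o - T o| <= C * `|t n|} ->
  {ae P, forall o, (t n)^-1 * (Tn n o - T o) @[n --> \oo] --> gT o} ->
  {ae P, forall o n, `|Un n o - U o| <= C * `|t n|} ->
  {ae P, forall o, (t n)^-1 * (Un n o - U o) @[n --> \oo] --> gU o} ->
  (t n ^+ 2)^-1 * \int[PP]_z mixed_diff (p n z.1) (p n z.2) (Tn n z.1) (Un n z.2)
    (T z.1) (U z.2)
    @[n --> \oo] -->
  \int[PP]_z mixed_limit (T z.1) (U z.2) (gT z.1) (gU z.2) (h z.1) (h z.2).
Proof.
move=> tn0 t0 bp bTn bUn pb cp Tb cT Ub cU.
have bmd n : bmeas (fun z : O * O => mixed_diff (p n z.1) (p n z.2) (Tn n z.1)
  (Un n z.2) (T z.1) (U z.2)).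
  have G (f g : O -> R) : bmeas f -> bmeas g -> bmeas (fun z : O * O => gauss (f
    z.1 - g z.2)).
    by move=> bf bg; apply: bmeas_gauss; case: (bmeasB (bmeas_fst bf) (bmeas_snd bg)).
  by apply: bmeasD; [apply: bmeasB; [apply: bmeasB|]|]; do ?apply: bmeasM;
    (exact: bmeas_fst || exact: bmeas_snd || exact: G).
rewrite (_ : (fun n => _) = (fun n => \int[PP]_z ((t n ^+ 2)^-1 *
    mixed_diff (p n z.1) (p n z.2) (Tn n z.1) (Un n z.2) (T z.1) (U z.2))));
      last first.
  by apply/funext => n; rewrite (Rint_bmeasZ PP).
apply: (@bmeas_dct _ _ _ PP _ _ (11 * C ^+ 2)).
- by move=> n; apply: (@bmeasM _ _ _ (cst _)); [exact: bmeas_cst|exact: bmd].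
- exact: bmeas_mixed_limit.
- have := ae_prod2 P cU; have := ae_prod1 P cT; apply: filterS2 => z c1 c2.
  exact: mixed_diff_cvg.
- have := ae_prod2 P Ub; have := ae_prod1 P Tb; apply: filterS2 => z b1 b2 n.
  have tp : 0 < t n ^+ 2 by rewrite lt_def sqrf_eq0 tn0 sqr_ge0.
  rewrite normrM normfV (gtr0_norm tp) mulrC ler_pdivrMr//.
  exact: mixed_diff_bound.
Qed.
End PairLimit.

Lemma bmeas_Lfun2 (R : realType) (d : measure_display) (T : measurableType d)
    (mu : probability T R) (f : T -> R) : bmeas f -> f \in Lfun mu 2%:E.
Proof.
move=> bf; have [mf _] := bf.
rewrite inE/=; apply/andP; split; rewrite inE//=.
rewrite /finite_norm unlock poweR_lty//.
under eq_integral => x _ /=.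
  rewrite (_ : `|f x| `^ 2 = f x ^+ 2); last first.
    by rewrite powR_mulrn// real_normK// num_real.
  over.
by apply/integrable_lty => //; exact: (bmeas_integrable mu (bmeasX 2 bf)).
Qed.

(** * The expansion of Psi *)

Section EqInDistribution.
Context (R : realType) (d : measure_display) (O : measurableType d).
Variables (P : probability O R) (f g : O -> R).
Hypotheses (mf : measurable_fun setT f) (mg : measurable_fun setT g).

Lemma eq_in_distribution_Rint (chi : R -> R) : eq_in_distribution P f g ->
  bmeas chi -> \int[P]_o chi (f o) = \int[P]_o chi (g o).
Proof.
move=> fg bchi; apply/eqP; rewrite -subr_eq0; apply/eqP.
have b (k : O -> R) h : measurable_fun setT k -> bmeas h -> bmeas (fun o => h (k
  o) : R).
  by move=> mk bh; exact: (bmeas_comp mk bh).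
have bf h bh := b f h mf bh; have bg h bh := b g h mg bh.
apply: (@bmeas_functional0 _ _ _
  (fun chi => \int[P]_o chi (f o) - \int[P]_o chi (g o)) 2) chi bchi.
- by move=> h1 h2 b1 b2; rewrite !Rint_bmeasD;
  [ring|exact: bg|exact: bg|exact: bf|exact: bf].
- by move=> c h bh; rewrite !Rint_bmeasZ; [ring|exact: bg|exact: bf].
- move=> h C bh hC; rewrite (le_trans (ler_normB _ _))// mulrDl mul1r lerD//.
    by apply: normr_Rint_le; [exact: bf|].
  by apply: normr_Rint_le; [exact: bg|].
- move=> B mB; apply/eqP; rewrite subr_eq0; apply/eqP.
  have E k : measurable_fun setT k -> \int[P]_o (\1_B (k o)) =
    fine (pushforward P k B).
    move=> mk; rewrite /pushforward -Rint_indic; last first.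
      by rewrite -[X in measurable X]setTI; exact: mk.
    by apply: eq_Rintegral => o _; rewrite !indicE; congr (nat_of_bool _)%:R;
      apply/idP/idP; rewrite !inE.
  by rewrite !E// fg.
Qed.
End EqInDistribution.

Section Algebra.
Context (R : realType) (d : measure_display) (O : measurableType d).
Variables (T U DT DU : probability O R -> O -> R) (P : probability O R).

(** Unit scores suffice: [mixed_limit] is homogeneous in (xi, al) and in (eta, be), so by
    [mixed_limit_scale] the factors h1(o1) and h1(o2) come out when the derivatives are D h1. *)
Lemma Gamma2E o1 o2 : Gamma2 T U DT DU P o1 o2 =
  mixed_limit (T P o1) (U P o2) (DT P o1) (DU P o2) 1 1.
Proof. by rewrite /Gamma2 /mixed_limit /dgauss /d2gauss /gauss; ring. Qed.

Lemma mixed_limit_scale (x y xi eta a b : R) :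
  mixed_limit x y (xi * a) (eta * b) a b = mixed_limit x y xi eta 1 1 * a * b.
Proof. by rewrite /mixed_limit; ring. Qed.
End Algebra.

Lemma Gamma2C (R : realType) (d : measure_display) (O : measurableType d)
    (T U DT DU : probability O R -> O -> R) (P : probability O R) o1 o2 :
  Gamma2 T U DT DU P o1 o2 = Gamma2 U T DU DT P o2 o1.
Proof. by rewrite !Gamma2E mixed_limitC. Qed.

(** * Degeneracy of Gamma and cancellation of the cross terms *)

Section MeanDiscrepancy.
Context (R : realType) (d : measure_display) (O : measurableType d).
Local Notation law := (probability O R).
Variables (M : set law) (P0 : law) (Rm Sm DR DS : law -> O -> R).
Hypotheses (npM : nonparametric M) (MP0 : M P0)
  (cR : classS M P0 Rm DR) (cS : classS M P0 Sm DS)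
  (RS : eq_in_distribution P0 (Rm P0) (Sm P0)).

Let bR := classS_bmeas cR MP0.
Let bS := classS_bmeas cS MP0.
Let bDR := classS_gradient_bmeas cR MP0.
Let bDS := classS_gradient_bmeas cS MP0.
Let PP := (P0 \x P0)%E.
Let b1 : bmeas (cst 1 : O -> R) := bmeas_cst O 1.

Lemma GammaC o1 o2 : Gamma Rm Sm DR DS P0 o1 o2 = Gamma Rm Sm DR DS P0 o2 o1.
Proof.
by rewrite /Gamma !(fun T U DT DU => @Gamma2C _ _ _ T U DT DU P0 o1 o2); ring.
Qed.

Let bGamma2 (T U DT DU : law -> O -> R) : bmeas (T P0) -> bmeas (U P0) ->
  bmeas (DT P0) -> bmeas (DU P0) ->
  bmeas (fun z : O * O => Gamma2 T U DT DU P0 z.1 z.2).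
Proof.
move=> bT bU bDT bDU; under eq_fun do rewrite Gamma2E.
exact: (@bmeas_mixed_limit _ _ _ _ _ (cst 1)).
Qed.

Lemma bmeas_Gamma : bmeas (fun z : O * O => Gamma Rm Sm DR DS P0 z.1 z.2).
Proof.
apply: bmeasD; last exact: bGamma2.
by apply: bmeasB; [apply: bmeasB|]; exact: bGamma2.
Qed.

(** The terms with DU have the form phi (U P0 o2) * DU P0 o2 and integrate to 0. The rest involves
    o2 through [U P0 o2] only, so under the null hypothesis it is the same for U = Rm and U = Sm. *)
Let Rint_Gamma2 (T U DT DU : law -> O -> R) o : bmeas (T P0) ->
  classS M P0 U DU ->
  \int[P0]_o2 Gamma2 T U DT DU P0 o o2 =
  \int[P0]_o2 (gauss (T P0 o - U P0 o2) + DT P0 o * dgauss (T P0 o - U P0 o2)).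
Proof.
move=> bT cU; have bU := classS_bmeas cU MP0;
  have bDU := classS_gradient_bmeas cU MP0.
pose phi y := - dgauss (T P0 o - y) - DT P0 o * d2gauss (T P0 o - y).
have my (S : O -> R) : bmeas S -> measurable_fun setT (fun o2 => T P0 o - S o2).
  by move=> [mS _]; exact: measurable_funB.
have m1 : measurable_fun setT (fun y : R => T P0 o - y) by exact: measurable_funB.
have bphi : bmeas phi.
  apply: bmeasB; first by apply: bmeasN; exact: bmeas_dgauss.
  by apply: (@bmeasM _ _ _ (cst _)); [exact: bmeas_cst|exact: bmeas_d2gauss].
have bchi : bmeas (fun o2 => gauss (T P0 o - U P0 o2) + DT P0 o * dgauss (T P0 o
  - U P0 o2)).
  apply: bmeasD; first by apply: bmeas_gauss; exact: my.
  by apply: (@bmeasM _ _ _ (cst _)); [exact: bmeas_cst|apply: bmeas_dgauss;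
    exact: my].
rewrite -[RHS]addr0 -(classS_gradient_centered cU MP0 bphi) -Rint_bmeasD//;
  last first.
  by apply: bmeasM => //; exact: (bmeas_comp bU.1 bphi).
by apply: eq_Rintegral => o2 _; rewrite Gamma2E /mixed_limit /phi; ring.
Qed.

Lemma Gamma_degenerate o : (\int[P0]_o2 (2 * Gamma Rm Sm DR DS P0 o o2)%:E = 0)%E.
Proof.
have bG := bmeas_section1 bmeas_Gamma o.
rewrite -[LHS]fineK; last first.
  apply: integrable_fin_num => //; apply: bmeas_integrable.
  by apply: (@bmeasM _ _ _ (cst 2)) => //; exact: bmeas_cst.
congr EFin; rewrite -[LHS]/(\int[P0]_o2 (2 * Gamma Rm Sm DR DS P0 o o2))
  Rint_bmeasZ//.
have b2 T U DT DU bT bU bDT bDU :=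
  bmeas_section1 (@bGamma2 T U DT DU bT bU bDT bDU) o.
rewrite /Gamma Rint_bmeasD; [|do ?apply: bmeasB; exact: b2|exact: b2].
rewrite Rint_bmeasB; [|apply: bmeasB; exact: b2|exact: b2].
rewrite Rint_bmeasB; [|exact: b2|exact: b2].
rewrite !Rint_Gamma2//.
have E (T DT : law -> O -> R) :
    \int[P0]_o2 (gauss (T P0 o - Rm P0 o2) + DT P0 o * dgauss (T P0 o - Rm P0 o2)) =
    \int[P0]_o2 (gauss (T P0 o - Sm P0 o2) + DT P0 o * dgauss (T P0 o - Sm P0 o2)).
  apply: (@eq_in_distribution_Rint _ _ _ _ _ _ bR.1 bS.1
    (fun y => gauss (T P0 o - y) + DT P0 o * dgauss (T P0 o - y)) RS).
  have m1 : measurable_fun setT (fun y : R => T P0 o - y) by exact: measurable_funB.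
  apply: bmeasD; first exact: bmeas_gauss.
  by apply: (@bmeasM _ _ _ (cst _)); [exact: bmeas_cst|exact: bmeas_dgauss].
by rewrite (E Rm DR) (E Sm DS); ring.
Qed.

Let m_diff (f g : O -> R) : bmeas f -> bmeas g ->
  bmeas (fun z : O * O => gauss (f z.1 - g z.2)).
Proof.
by move=> bf bg; apply: bmeas_gauss; case: (bmeasB (bmeas_fst bf) (bmeas_snd bg)).
Qed.

Let Phi_density (T U : law -> O -> R) (Q : law) (p : O -> R) :
  bmeas p -> has_density P0 p Q -> bmeas (T Q) -> bmeas (U Q) ->
  Phi T U Q = \int[PP]_z (p z.1 * p z.2 * gauss (T Q z.1 - U Q z.2)).
Proof.
move=> bp hQ bT bU; have bF := m_diff bT bU.
rewrite /Phi (density_Rint bp hQ); last exact: (bmeas_Rint2 Q Q bF).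
have bG : bmeas (fun z : O * O => p z.1 * p z.2 * gauss (T Q z.1 - U Q z.2)).
  by apply: bmeasM => //; apply: bmeasM; [exact: bmeas_fst|exact: bmeas_snd].
rewrite -(Rint_fubini2 P0 P0 bG); apply: eq_Rintegral => o2 _ /=.
rewrite (density_Rint bp hQ); last exact: (bmeas_section2 bF o2).
rewrite mulrC -Rint_bmeasZ; last by apply: bmeasM => //;
  exact: (bmeas_section2 bF o2).
by apply: eq_Rintegral => o1 _; rewrite /gauss; ring.
Qed.

(** Only one coordinate has moved: p and f belong to the perturbed law, g to P0. By [cross_eq] the
    choice of g between [Rm P0] and [Sm P0] does not matter. *)
Let cross (p f g : O -> R) := \int[PP]_z (p z.1 * gauss (f z.1 - g z.2)).

Let cross_eq (p f : O -> R) : bmeas p -> bmeas f -> cross p f (Rm P0) =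
  cross p f (Sm P0).
Proof.
move=> bp bf.
have b (g : O -> R) : bmeas g -> bmeas (fun z : O * O => p z.1 * gauss (f z.1 - g
  z.2)).
  by move=> bg; apply: bmeasM; [exact: bmeas_fst|exact: m_diff].
rewrite /cross -(Rint_fubini1 P0 P0 (b _ bR)) -(Rint_fubini1 P0 P0 (b _ bS)).
apply: eq_Rintegral => o1 _ /=.
apply: (@eq_in_distribution_Rint _ _ _ _ _ _ bR.1 bS.1 (fun y => p o1 * gauss (f
  o1 - y)) RS).
apply: (@bmeasM _ _ _ (cst _)); first exact: bmeas_cst.
by apply: bmeas_gauss; exact: measurable_funB.
Qed.

Let crossC (p f g : O -> R) : bmeas p -> bmeas f -> bmeas g ->
  cross p f g = \int[PP]_z (p z.2 * gauss (g z.1 - f z.2)).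
Proof.
move=> bp bf bg.
have b : bmeas (fun z : O * O => p z.1 * gauss (f z.1 - g z.2)).
  by apply: bmeasM; [exact: bmeas_fst|exact: m_diff].
have b' : bmeas (fun z : O * O => p z.2 * gauss (g z.1 - f z.2)).
  by apply: bmeasM; [exact: bmeas_snd|exact: m_diff].
rewrite /cross -(Rint_fubini1 P0 P0 b) -(Rint_fubini2 P0 P0 b').
apply: eq_Rintegral => x _; apply: eq_Rintegral => y _ /=.
by rewrite /gauss -(opprB (f x)) sqrrN.
Qed.

Let Rint_mixed_diff (T U : law -> O -> R) (Q : law) (p : O -> R) :
  bmeas p -> has_density P0 p Q -> bmeas (T Q) -> bmeas (U Q) ->
  bmeas (T P0) -> bmeas (U P0) ->
  \int[PP]_z mixed_diff (p z.1) (p z.2) (T Q z.1) (U Q z.2) (T P0 z.1) (U P0 z.2) =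
  Phi T U Q - cross p (T Q) (U P0) - cross p (U Q) (T P0) + cross (cst 1) (T P0)
    (U P0).
Proof.
move=> bp hQ bT bU bT0 bU0.
rewrite (Phi_density bp hQ bT bU) (crossC bp bU bT0) /cross.
have bp1 := bmeas_fst bp; have bp2 := bmeas_snd bp.
have g1 := m_diff bT bU; have g2 := m_diff bT bU0; have g3 := m_diff bT0 bU;
  have g4 := m_diff bT0 bU0.
have i1 := bmeasM (bmeasM bp1 bp2) g1; have i2 := bmeasM bp1 g2;
  have i3 := bmeasM bp2 g3.
rewrite /mixed_diff (Rint_bmeasD PP (bmeasB (bmeasB i1 i2) i3) g4).
rewrite (Rint_bmeasB PP (bmeasB i1 i2) i3) (Rint_bmeasB PP i1 i2).
by congr (_ + _); apply: eq_Rintegral => z _; rewrite mul1r.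
Qed.

Let Phi_cross (T U : law -> O -> R) : bmeas (T P0) -> bmeas (U P0) ->
  Phi T U P0 = cross (cst 1) (T P0) (U P0).
Proof.
move=> bT bU; rewrite (@Phi_density _ _ _ (cst 1))//.
  by apply: eq_Rintegral => z _; rewrite mul1r.
by move=> A mA; rewrite -[LHS]mul1e; exact/esym/(integral_cst P0 mA 1).
Qed.

Lemma Psi_P0 : Psi Rm Sm P0 = 0.
Proof.
have E : cross (cst 1) (Sm P0) (Rm P0) = cross (cst 1) (Rm P0) (Sm P0).
  exact: crossC.
rewrite /Psi !Phi_cross// (cross_eq b1 bR) -(cross_eq b1 bS) E. ring.
Qed.

(** By [cross_eq] a cross term depends only on its moving function. That of [Rm Q] has coefficient
    -2 from the pair (Rm, Rm) and +2 from -2 times (Rm, Sm); likewise for [Sm Q]. The terms at P0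
    add up to [Psi Rm Sm P0] = 0. *)
Lemma Psi_mixed_diff (Q : law) (p : O -> R) : bmeas p -> has_density P0 p Q -> M Q ->
  let md (T U : law -> O -> R) :=
    \int[PP]_z mixed_diff (p z.1) (p z.2) (T Q z.1) (U Q z.2) (T P0 z.1) (U P0 z.2) in
  Psi Rm Sm Q - Psi Rm Sm P0 = md Rm Rm - 2 * md Rm Sm + md Sm Sm.
Proof.
move=> bp hQ MQ md; rewrite /md.
have bRQ := classS_bmeas cR MQ; have bSQ := classS_bmeas cS MQ.
rewrite !(Rint_mixed_diff bp hQ)// -!Phi_cross//.
rewrite !(cross_eq bp bRQ) !(cross_eq bp bSQ).
have := Psi_P0; rewrite /Psi.
move: (Phi Rm Rm P0) (Phi Rm Sm P0) (Phi Sm Sm P0) => c1 c2 c3.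
move: (Phi Rm Rm Q) (Phi Rm Sm Q) (Phi Sm Sm Q) => d1 d2 d3.
move: (cross p (Rm Q) (Sm P0)) (cross p (Sm Q) (Sm P0)) => e1 e2 H; lra.
Qed.
End MeanDiscrepancy.

(** * Passage to the limit *)

Section SecondOrder.
Context (R : realType) (d : measure_display) (O : measurableType d).
Local Notation law := (probability O R).
Variables (M : set law) (P0 : law).
Hypotheses (npM : nonparametric M) (MP0 : M P0).
Let PP := (P0 \x P0)%E.

Let gradient_limit (T U DT DU : law -> O -> R) (h : O -> R) :=
  \int[PP]_z (Gamma2 T U DT DU P0 z.1 z.2 * h z.1 * h z.2).

Lemma Gamma2_limit (T U DT DU : law -> O -> R) (h gT gU : O -> R) :
  classS M P0 T DT -> classS M P0 U DU -> bmeas h -> bmeas gT -> bmeas gU ->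
  (forall phi : R -> R, bmeas phi ->
      \int[P0]_o (phi (T P0 o) * gT o) =
        \int[P0]_o (phi (T P0 o) * (DT P0 o * h o))) ->
  (forall phi : R -> R, bmeas phi ->
      \int[P0]_o (phi (U P0 o) * gU o) =
        \int[P0]_o (phi (U P0 o) * (DU P0 o * h o))) ->
  \int[PP]_z mixed_limit (T P0 z.1) (U P0 z.2) (gT z.1) (gU z.2) (h z.1) (h z.2) =
  gradient_limit T U DT DU h.
Proof.
move=> cT cU bh bgT bgU HT HU.
have bT := classS_bmeas cT MP0; have bU := classS_bmeas cU MP0.
have bDT := classS_gradient_bmeas cT MP0; have bDU := classS_gradient_bmeas cU MP0.
have bDTh := bmeasM bDT bh; have bDUh := bmeasM bDU bh.
rewrite (mixed_limit_swapl bT bU bh bgT bDTh bgU HT).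
rewrite (mixed_limit_swapr bT bU bh bDTh bgU bDUh HU).
by apply: eq_Rintegral => z _; rewrite mixed_limit_scale Gamma2E.
Qed.

Lemma pair_expansion (T U DT DU : law -> O -> R) (h1 h2 : O -> R) (Pt : R -> law) :
  classS M P0 T DT -> classS M P0 U DU ->
  bounded_score P0 h1 -> bounded_score P0 h2 ->
  submodel M P0 (quadratic_path h1 h2) Pt ->
  let p := quadratic_path h1 h2 in
  exists2 a : R, 0 < a & forall t : nat -> R,
    (forall n, `|t n| < a) -> (forall n, t n != 0) -> t n @[n --> \oo] --> 0 ->
    (t n ^+ 2)^-1 * \int[PP]_z mixed_diff (p (t n) z.1) (p (t n) z.2)
      (T (Pt (t n)) z.1) (U (Pt (t n)) z.2) (T P0 z.1) (U P0 z.2)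
    @[n --> \oo] --> gradient_limit T U DT DU h1.
Proof.
move=> cT cU s1 s2 sub p.
have [CT [aT [gT [aT0 bgT HT limT]]]] := classS_expansion cT npM MP0 s1 s2 sub.
have [CU [aU [gU [aU0 bgU HU limU]]]] := classS_expansion cU npM MP0 s1 s2 sub.
have [mh1 [C1 hC1] _] := s1; have [mh2 [C2 hC2] _] := s2.
have bh1 : bmeas h1 by split => //; exists C1.
have bh2 : bmeas h2 by split => //; exists C2.
have [_ [r /= r0 hr]] := sub.
pose a := Order.min (Order.min aT aU) (Order.min r 1).
exists a; first by rewrite !lt_min aT0 aU0 r0 ltr01.
move=> t ta tn0 t0.
have taT n : `|t n| < aT by rewrite (lt_le_trans (ta n))// /a !ge_min lexx.
have taU n : `|t n| < aU by rewrite (lt_le_trans (ta n))// /a !ge_min lexx orbT.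
have tr n : `|t n| < r by rewrite (lt_le_trans (ta n))// /a !ge_min lexx !orbT.
have t1 n : `|t n| < 1 by rewrite (lt_le_trans (ta n))// /a !ge_min lexx !orbT.
have [bT cvT] := limT t taT tn0 t0; have [bU cvU] := limU t taU tn0 t0.
have Mt n : M (Pt (t n)).
  by have [] := hr (t n) ltac:(by rewrite /= sub0r normrN).
have bZ x (f : O -> R) : bmeas f -> bmeas (fun o => x * f o).
  by move=> bf; apply: (@bmeasM _ _ _ (cst x)) => //; exact: bmeas_cst.
have bp s : bmeas (p s).
  by apply: bmeasD; [apply: (@bmeasD _ _ _ (cst 1));
    [exact: bmeas_cst|exact: bZ]|exact: bZ].
(* One constant for T, U and the density; for the latter |t n| < 1 absorbs the quadratic term. *)
pose C := `|CT| + `|CU| + (`|C1| + `|C2|).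
have C1C : `|C1| + `|C2| <= C by rewrite /C lerDr addr_ge0.
have CTC : CT <= C by rewrite (le_trans (ler_norm _))// /C -addrA lerDl !addr_ge0.
have CUC : CU <= C.
  by rewrite (le_trans (ler_norm _))// /C -addrA addrCA lerDl !addr_ge0.
have pE n o : p (t n) o - 1 = t n * (h1 o + t n * h2 o).
  by rewrite /p /quadratic_path; ring.
rewrite -(Gamma2_limit cT cU bh1 bgT bgU HT HU).
apply: (@pair_limit _ _ _ P0 (T P0) (U P0) gT gU h1
  (classS_bmeas cT MP0) (classS_bmeas cU MP0) bgT bgU bh1 t (fun n => p (t n))
  (fun n => T (Pt (t n))) (fun n => U (Pt (t n))) C) => //.
- by move=> n; exact: (classS_bmeas cT (Mt n)).
- by move=> n; exact: (classS_bmeas cU (Mt n)).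
- move=> n o; rewrite pE normrM mulrC ler_wpM2r//.
  rewrite (le_trans _ C1C)// (le_trans (ler_normD _ _))// lerD//.
    by rewrite (le_trans (hC1 o))// ler_norm.
  rewrite normrM -[leRHS]mul1r ler_pM//; first exact: ltW.
  by rewrite (le_trans (hC2 o))// ler_norm.
- move=> o.
  rewrite (_ : (fun n => _) = (fun n => h1 o + t n * h2 o)); last first.
    by apply/funext => n; rewrite pE mulKf.
  rewrite -[X in _ --> X]addr0 -(mul0r (h2 o)); apply: cvgD; first exact: cvg_cst.
  by apply: cvgM => //; exact: cvg_cst.
- by apply: filterS bT => o + n => /(_ n) /le_trans; apply; rewrite ler_wpM2r.
- by apply: filterS bU => o + n => /(_ n) /le_trans; apply; rewrite ler_wpM2r.
Qed.

Variables (Rm Sm DR DS : law -> O -> R).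
Hypotheses (cR : classS M P0 Rm DR) (cS : classS M P0 Sm DS)
  (RS : eq_in_distribution P0 (Rm P0) (Sm P0)).

Let bGamma2 (T U DT DU : law -> O -> R) : classS M P0 T DT -> classS M P0 U DU ->
  bmeas (fun z : O * O => Gamma2 T U DT DU P0 z.1 z.2).
Proof.
move=> cT cU; under eq_fun do rewrite Gamma2E.
apply: (@bmeas_mixed_limit _ _ _ _ _ (cst 1)).
- exact: (classS_bmeas cT MP0).
- exact: (classS_bmeas cU MP0).
- exact: bmeas_cst.
- exact: (classS_gradient_bmeas cT MP0).
- exact: (classS_gradient_bmeas cU MP0).
Qed.

Lemma Gamma_limit (h : O -> R) : bmeas h ->
  \int[P0]_o1 \int[P0]_o2 (2 * Gamma Rm Sm DR DS P0 o1 o2 * h o1 * h o2) =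
  2 * (gradient_limit Rm Rm DR DR h - 2 * gradient_limit Rm Sm DR DS h
       + gradient_limit Sm Sm DS DS h).
Proof.
move=> bh.
have b T U DT DU cT cU := bmeasM (bmeasM (@bGamma2 T U DT DU cT cU) (bmeas_fst
  bh)) (bmeas_snd bh).
have bG : bmeas (fun z : O * O => 2 * (
    Gamma2 Rm Rm DR DR P0 z.1 z.2 * h z.1 * h z.2
    - Gamma2 Rm Sm DR DS P0 z.1 z.2 * h z.1 * h z.2
    - Gamma2 Sm Rm DS DR P0 z.1 z.2 * h z.1 * h z.2
    + Gamma2 Sm Sm DS DS P0 z.1 z.2 * h z.1 * h z.2)).
  apply: (@bmeasM _ _ _ (cst 2)); first exact: bmeas_cst.
  by apply: bmeasD; [apply: bmeasB; [apply: bmeasB|]|]; exact: b.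
transitivity (\int[P0]_o1 \int[P0]_o2 (2 * (
    Gamma2 Rm Rm DR DR P0 o1 o2 * h o1 * h o2
    - Gamma2 Rm Sm DR DS P0 o1 o2 * h o1 * h o2
    - Gamma2 Sm Rm DS DR P0 o1 o2 * h o1 * h o2
    + Gamma2 Sm Sm DS DS P0 o1 o2 * h o1 * h o2))).
  apply: eq_Rintegral => o1 _; apply: eq_Rintegral => o2 _.
  by rewrite /Gamma; ring.
rewrite (Rint_fubini1 P0 P0 bG).
rewrite (Rint_bmeasZ PP); last first.
  by apply: bmeasD; [apply: bmeasB; [apply: bmeasB|]|]; exact: b.
rewrite (Rint_bmeasD PP); [|by apply: bmeasB; [apply: bmeasB|]; exact: b|exact: b].
rewrite (Rint_bmeasB PP); [|by apply: bmeasB; exact: b|exact: b].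
rewrite (Rint_bmeasB PP); [|exact: b|exact: b].
(* Exchanging o1 and o2 merges the two mixed terms of Gamma into the single weight -2 of Psi. *)
have SR : gradient_limit Sm Rm DS DR h = gradient_limit Rm Sm DR DS h.
  rewrite /gradient_limit -(Rint_fubini1 P0 P0 (b _ _ _ _ cS cR)).
  rewrite -(Rint_fubini2 P0 P0 (b _ _ _ _ cR cS)).
  by apply: eq_Rintegral => x _; apply: eq_Rintegral => y _ /=;
    rewrite Gamma2C mulrAC.
rewrite -[LHS]/(2 * (gradient_limit Rm Rm DR DR h - gradient_limit Rm Sm DR DS h
  - gradient_limit Sm Rm DS DR h + gradient_limit Sm Sm DS DS h)) SR.
move: (gradient_limit _ _ _ _ _) (gradient_limit _ _ _ _ _) (gradient_limit _ _ _
  _ _).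
by move=> x y z; ring.
Qed.

(** Both expansions in the theorem follow: e = 1 gives a difference of order t^2, hence first-order
    gradient 0, and arbitrary e gives the second-order remainder. *)
Lemma Psi_expansion (h1 h2 : O -> R) (Pt : R -> law) :
  bounded_score P0 h1 -> bounded_score P0 h2 ->
  submodel M P0 (quadratic_path h1 h2) Pt ->
  forall e : R, 0 < e -> \forall t \near (0 : R),
    `|Psi Rm Sm (Pt t) - Psi Rm Sm P0 - 2^-1 * t ^+ 2 *
      \int[P0]_o1 \int[P0]_o2 (2 * Gamma Rm Sm DR DS P0 o1 o2 * h1 o1 * h1 o2)|
    <= e * t ^+ 2.
Proof.
move=> s1 s2 sub e e0.
have [mh1 [C1 hC1] _] := s1; have [mh2 [C2 hC2] _] := s2.
have bh1 : bmeas h1 by split => //; exists C1.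
have bh2 : bmeas h2 by split => //; exists C2.
have [Pt0 [r /= r0 hr]] := sub.
have [a1 a10 lim1] := pair_expansion cR cR s1 s2 sub.
have [a2 a20 lim2] := pair_expansion cR cS s1 s2 sub.
have [a3 a30 lim3] := pair_expansion cS cS s1 s2 sub.
pose L := gradient_limit Rm Rm DR DR h1 - 2 * gradient_limit Rm Sm DR DS h1
       + gradient_limit Sm Sm DS DS h1.
rewrite Gamma_limit// -/L.
have bZ x (f : O -> R) : bmeas f -> bmeas (fun o => x * f o).
  by move=> bf; apply: (@bmeasM _ _ _ (cst x)) => //; exact: bmeas_cst.
have bp s : bmeas (quadratic_path h1 h2 s).
  by apply: bmeasD; [apply: (@bmeasD _ _ _ (cst 1));
    [exact: bmeas_cst|exact: bZ]|exact: bZ].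
have : (t ^+ 2)^-1 * (Psi Rm Sm (Pt t) - Psi Rm Sm P0) @[t --> 0^'] --> L.
  apply/cvgr_dnbhsP => u [un0 u0].
  pose a := Order.min (Order.min a1 a2) (Order.min a3 r).
  have a0 : 0 < a by rewrite !lt_min a10 a20 a30 r0.
  have [N _ HN] : \forall n \near \oo, `|u n| < a.
    move/cvgrPdist_lt : u0 => /(_ a a0).
    by apply: filterS => n; rewrite sub0r normrN.
  (* [pair_expansion] asks for |t n| < a at every n; dropping the first N terms ensures it. *)
  pose t n := u (n + N)%N.
  have ta n : `|t n| < a by apply: HN; rewrite /= leq_addl.
  have t0 : t n @[n --> \oo] --> 0 by rewrite /t (cvg_shiftn N).
  have tn0 n : t n != 0 by exact: un0.
  have ta1 n : `|t n| < a1 by rewrite (lt_le_trans (ta n))// /a !ge_min lexx.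
  have ta2 n : `|t n| < a2 by rewrite (lt_le_trans (ta n))// /a !ge_min lexx orbT.
  have ta3 n : `|t n| < a3 by rewrite (lt_le_trans (ta n))// /a !ge_min lexx !orbT.
  have tr n : `|t n| < r by rewrite (lt_le_trans (ta n))// /a !ge_min lexx !orbT.
  pose md T U n := (t n ^+ 2)^-1 * \int[PP]_z mixed_diff (quadratic_path h1 h2 (t
    n) z.1)
    (quadratic_path h1 h2 (t n) z.2) (T (Pt (t n)) z.1) (U (Pt (t n)) z.2) (T P0
      z.1) (U P0 z.2).
  have H : md Rm Rm n - 2 * md Rm Sm n + md Sm Sm n @[n --> \oo] --> L.
    apply: cvgD; last exact: (lim3 t ta3 tn0 t0).
    apply: cvgB; first exact: (lim1 t ta1 tn0 t0).
    by apply: cvgM; [exact: cvg_cst|exact: (lim2 t ta2 tn0 t0)].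
  rewrite -(cvg_shiftn N) [X in X @ _ --> _](_ : _ =
    (fun n => md Rm Rm n - 2 * md Rm Sm n + md Sm Sm n))//.
  apply/funext => n; rewrite /= -/(t n).
  have [Mn dn] := hr (t n) ltac:(by rewrite /= sub0r normrN).
  rewrite (Psi_mixed_diff MP0 cR cS RS (bp (t n)) dn Mn) /md /=.
  move: (\int[_]_z _) (\int[_]_z _) (\int[_]_z _) => x y z; ring.
move=> /cvgrPdist_le/(_ e e0)[q /= q0 hq].
exists q => // t tq.
(* The punctured limit says nothing at t = 0, where [Pt 0 = P0] settles the inequality. *)
have [->|tn0] := eqVneq t 0.
  by rewrite Pt0 subrr expr0n/= !(mulr0, mul0r) subrr normr0.
have t2 : 0 < t ^+ 2 by rewrite lt_def sqrf_eq0 tn0 sqr_ge0.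
have := hq t tq tn0.
rewrite -(ler_pM2r t2) -[X in _ * X <= _](gtr0_norm t2) -normrM => H.
have t2n0 : t ^+ 2 != 0 by rewrite gt_eqF.
have -> : Psi Rm Sm (Pt t) - Psi Rm Sm P0 - 2^-1 * t ^+ 2 * (2 * L) =
    ((t ^+ 2)^-1 * (Psi Rm Sm (Pt t) - Psi Rm Sm P0) - L) * t ^+ 2.
  by field.
by rewrite -opprB mulNr normrN.
Qed.
End SecondOrder.

Theorem theorem2 (R : realType) (d : measure_display) (O : measurableType d)
    (M : set (probability O R)) (P0 : probability O R)
    (Rm Sm DR DS : probability O R -> O -> R) :
  nonparametric M -> M P0 ->
  classS M P0 Rm DR -> classS M P0 Sm DS ->
  eq_in_distribution P0 (Rm P0) (Sm P0) ->
  second_order_gradient M (Psi Rm Sm) P0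
    (fun o1 o2 => 2 * Gamma Rm Sm DR DS P0 o1 o2).
Proof.
move=> npM MP0 cR cS RS.
have D10 (h : O -> R) : \int[P0]_o (cst 0 o * h o) = 0.
  by rewrite -[RHS](Rint_cst P0); apply: eq_Rintegral => o _; rewrite mul0r.
split.
- split; first by move=> o1 o2; rewrite GammaC.
  exact: (Gamma_degenerate MP0 cR cS RS).
- apply: bmeas_Lfun2; apply: (@bmeasM _ _ _ (cst 2)); first exact: bmeas_cst.
  exact: (bmeas_Gamma MP0 cR cS).
- exists (cst 0).
    split; [exact: Lfun_cst|exact: Rint_cst|].
    move=> h1 h2 Pt s1 s2 sub; apply/eqoP => e e0.
    have := Psi_expansion npM MP0 cR cS RS s1 s2 sub ltr01.
    set I := \int[P0]_o1 _ => H.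
    (* The 1 bounds the remainder and the other term the quadratic part, so the difference is at
       most c * t^2, which is at most e * |t| once |t| <= e / c. *)
    pose c := 1 + `|2^-1 * I|.
    have c0 : 0 < c by rewrite ltr_pwDl.
    have t_small : \forall t \near (0 : R), `|t| <= e / c.
      have ec0 : 0 < e / c by rewrite divr_gt0.
      by exists (e / c) => // t; rewrite /= sub0r normrN => /ltW.
    near=> t.
    rewrite D10 mulr0 subr0.
    have Ht : `|Psi Rm Sm (Pt t) - Psi Rm Sm P0 - 2^-1 * t ^+ 2 * I|
      <= 1 * t ^+ 2 by near: t.
    have te : `|t| <= e / c by near: t.
    have : `|Psi Rm Sm (Pt t) - Psi Rm Sm P0| <= c * t ^+ 2.
      rewrite -[X in `|X|](subrK (2^-1 * t ^+ 2 * I)).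
      rewrite (le_trans (ler_normD _ _))// /c mulrDl lerD//.
      by rewrite mulrAC normrM [`|t ^+ 2|]ger0_norm// sqr_ge0.
    move=> /le_trans; apply.
    rewrite -[t ^+ 2]real_normK ?num_real// expr2 mulrA ler_wpM2r//.
    by rewrite mulrC -ler_pdivlMr.
  move=> h1 h2 Pt s1 s2 sub; apply/eqoP => e e0.
  have := Psi_expansion npM MP0 cR cS RS s1 s2 sub e0.
  apply: filterS => t; rewrite !D10 !mulr0 !add0r => /le_trans; apply.
  by rewrite ger0_norm// sqr_ge0.
Unshelve. all: by end_near. Qed.
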